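(* Let $\epsilon\in\{-1,0,1\}$ and $f\in L^2(\Omega)$. (i) If $(u_h,\hat u_h)\in\mathbf V_h$ solves the H-IP problem, then $u_h\in V_h$ solves the UIP-DG problem. (ii) If $u_h\in V_h$ solves the UIP-DG problem and $\hat u_h$ is defined by $\hat u_h:=\{u_h\}_{\omega^\tau}-\varrho_1[\kappa\nabla_hu_h]$ on every interior face and $\hat u_h:=0$ on every boundary face, then $\hat u_h\in\hat V_h$ and $(u_h,\hat u_h)$ solves the H-IP problem; in particular, if the H-IP problem has a unique solution, $(u_h,\hat u_h)$ is that solution.
   Context: Setting. Let $\Omega\subset\mathbb R^d$, $d\in\{2,3\}$, be a bounded polyhedral Lipschitz domain. Let $\kappa:\Omega\to\mathbb R^{d\times d}$ be symmetric with $\kappa_{\min}|\xi|^2\le\xi^\top\kappa(x)\xi\le\kappa_{\max}|\xi|^2$ for all $\xi\in\mathbb R^d$ and a.e. $x$, where $0<\kappa_{\min}\le\kappa_{\max}<\infty$. Let $\mathcal T_h$ be a conforming affine simplicial mesh of $\Omega$ from a shape-regular family, with $h_E=\operatorname{diam}E$, $h=\max_Eh_E\le1$, and assume $\kappa$ is constant on each element, $\kappa_E:=\kappa|_E$. $\mathcal F_h=\mathcal F_h^i\cup\mathcal F_h^b$ is the set of faces (edges if $d=2$), split into interior and boundary faces; $\mathcal F_E$ is the set of faces of $E$, $n_{E,F}$ the unit outward normal to $F\in\mathcal F_E$, and $\eta_0:=\max_E\#\mathcal F_E$. For an interior face $F=\partial E_1\cap\partial E_2$, a subscript $i\in\{1,2\}$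 denotes the trace from $E_i$ and $n_i:=n_{E_i,F}$. $\nabla_h$ is the elementwise gradient; $(\cdot,\cdot)_{\mathcal T_h}:=\sum_E(\cdot,\cdot)_{L^2(E)}$, $\langle\cdot,\cdot\rangle_{\partial\mathcal T_h}:=\sum_E\sum_{F\in\mathcal F_E}\langle\cdot,\cdot\rangle_{L^2(F)}$ (traces from $E$), $\langle\cdot,\cdot\rangle_{\mathcal F}:=\sum_{F\in\mathcal F}\langle\cdot,\cdot\rangle_{L^2(F)}$ for a set $\mathcal F$ of faces. Fix $k\ge1$: $V_h:=\{v\in L^2(\Omega):v|_E\in\mathbb P_k(E)\ \forall E\}$, $\hat V_h:=\{\hat v\in L^2(\bigcup_{F\in\mathcal F_h}F):\hat v|_F\in\mathbb P_k(F)\ \forall F,\ \hat v|_F=0\ \forall F\in\mathcal F_h^b\}$, $\mathbf V_h:=V_h\times\hat V_h$ ($\mathbb P_k$ = polynomials of total degree $\le k$). Trace operators. For an interior face and a pair of weights $(\omega_1,\omega_2)$ with $\omega_1+\omega_2=1$ (boundary faces: $(1,0)$): $[\varphi]:=\varphi_1n_1+\varphi_2n_2$, $\{\varphi\}_\omega:=\omega_1\varphi_1+\omega_2\varphi_2$, $\{\varphi\}^*_\omega:=\omega_2\varphi_1+\omega_1\varphi_2$; on a boundary face $F\subset\partial E$: $[\varphi]:=\varphi|_En_{E,F}$, $\{\varphi\}_\omega=\{\varphi\}^*_\omega:=\varphi|_E$. Means of vector fields are componentwise; for a vector field $\mathbf b$, $[\mathbf b]:=\mathbf b_1\cdot n_1+\mathbf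 b_2\cdot n_2$ (scalar) on interior faces. HDG jump: $[\![(\varphi,\hat\varphi)]\!]|_{E,F}:=(\varphi|_E-\hat\varphi)n_{E,F}$ for $F\in\mathcal F_E$. Penalty and coefficients. Let $C_T>0$ be such that $\|w\|_{L^2(F)}^2\le C_T^2h_E^{-1}\|w\|_{L^2(E)}^2$ for all $E$, $F\in\mathcal F_E$, $w\in\mathbb P_k(E)$. Fix $\alpha_0>0$ and set $\tau|_{E,F}:=\alpha_0C_T^2\kappa_{E,F}h_E^{-1}$ with $\kappa_{E,F}:=n_{E,F}^\top\kappa_En_{E,F}$. On an interior face with $\tau_i:=\tau|_{E_i,F}$: $\omega^\tau_i:=\tau_i/(\tau_1+\tau_2)$, $\varrho_0:=\tau_1\tau_2/(\tau_1+\tau_2)$, $\varrho_1:=1/(\tau_1+\tau_2)$; on a boundary face $F\subset\partial E$: $\omega^\tau:=(1,0)$, $\varrho_0:=\tau|_{E,F}$. H-IP method. For $\epsilon\in\{-1,0,1\}$, $\sigma(v):=-\kappa\nabla_hv$, and for $\mathbf u=(u,\hat u)\in\mathbf V_h$, $\hat\sigma(\mathbf u):=\sigma(u)+\tau[\![\mathbf u]\!]$ on $\partial\mathcal T_h$ (double-valued). $\mathbf a_h^{(\epsilon)}(\mathbf u,\mathbf v):=(\kappa\nabla_hu,\nabla_hv)_{\mathcal T_h}+\langle\hat\sigma(\mathbf u),[\![\mathbf v]\!]\rangle_{\partial\mathcal T_h}+\epsilon\langle\sigma(v),[\![\mathbf u]\!]\rangle_{\partial\mathcal T_h}$ for $\mathbf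 u=(u,\hat u),\mathbf v=(v,\hat v)\in\mathbf V_h$. The H-IP problem: find $\mathbf u_h\in\mathbf V_h$ with $\mathbf a_h^{(\epsilon)}(\mathbf u_h,\mathbf v_h)=(f,v_h)_{\mathcal T_h}$ for all $\mathbf v_h=(v_h,\hat v_h)\in\mathbf V_h$. UIP-DG method. For $u,v$ with $u|_E,v|_E\in H^2(E)$ for all $E$: $a_h^{(\epsilon)}(u,v):=(\kappa\nabla_hu,\nabla_hv)_{\mathcal T_h}+a^c_h(u,v)+\epsilon\,a^c_h(v,u)+s^{(\epsilon)}_h(u,v)$, where $a^c_h(u,v):=-\langle\{\kappa\nabla_hu\}^*_{\omega^\tau},[v]\rangle_{\mathcal F_h}$ and $s_h^{(\epsilon)}(u,v):=\langle\varrho_0[u],[v]\rangle_{\mathcal F_h}-\epsilon\langle\varrho_1[\kappa\nabla_hu],[\kappa\nabla_hv]\rangle_{\mathcal F_h^i}$. The UIP-DG problem: find $u_h\in V_h$ with $a_h^{(\epsilon)}(u_h,v_h)=(f,v_h)_{\mathcal T_h}$ for all $v_h\in V_h$. *)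

(* Defs.v *)
From HB Require Import structures.
From mathcomp Require Import all_boot all_order all_algebra.
From mathcomp Require Import all_classical all_reals all_analysis.
From mathcomp Require mpoly.

Unset Printing Implicit Defensive.

Import Order.TTheory GRing.Theory Num.Theory.
Import numFieldNormedType.Exports.
Local Open Scope classical_set_scope.
Local Open Scope ring_scope.

(* Throughout, the space dimension is d = n.+1 and points of R^d are row vectors 'rV[R]_n.+1. *)

Definition dotv {R : realType} {m : nat} (a b : 'rV[R]_m) : R := (a *m b^T) 0 0.
Definition enorm {R : realType} {m : nat} (a : 'rV[R]_m) : R := Num.sqrt (dotv a a).

Definition hullset {R : realType} {m : nat} {I : finType} (p : I -> 'rV[R]_m) (A : {set I})
  : set 'rV[R]_m :=
  [set x | exists w : I -> R, (forall i, 0 <= w i) /\ (forall i, i \notin A -> w i = 0) /\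
     \sum_i w i = 1 /\ x = \sum_i w i *: p i].

Definition consrow {R : realType} {m : nat} (t : R) (y : 'rV[R]_m) : 'rV[R]_m.+1 :=
  \row_i (if unlift ord0 i is Some j then y 0 j else t).

Fixpoint iint {R : realType} {m : nat} : ('rV[R]_m -> R) -> R :=
  match m with
  | 0 => fun g => g 0
  | m'.+1 => fun g => Rintegral lebesgue_measure setT (fun t => iint (fun y => g (consrow t y)))
  end.

Fixpoint iintE {R : realType} {m : nat} : ('rV[R]_m -> \bar R) -> \bar R :=
  match m with
  | 0 => fun g => g 0
  | m'.+1 => fun g => (\int[lebesgue_measure]_t iintE (fun y => g (consrow t y)))%E
  end.

(* f in L^2(Omega): Borel measurable (via the product sigma-algebra on (n.+1)-tuples) and
   square-integrable over Omega *)
Definition L2 {R : realType} {n : nat} (Omega : set 'rV[R]_n.+1) (f : 'rV[R]_n.+1 -> R) : Prop :=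
  measurable_fun [set: (n.+1).-tuple R] (fun t => f (\row_i tnth t i)) /\
  (iintE (fun x => ((\1_Omega x : R) * f x ^+ 2)%:E) < +oo)%E.

Definition lipschitz_fun {R : realType} {m : nat} (g : 'rV[R]_m -> R) : Prop :=
  exists L : R, forall a b, `|g a - g b| <= L * enorm (a - b).

Definition first_coords {R : realType} {n : nat} (z : 'rV[R]_n.+1) : 'rV[R]_n :=
  \row_(i < n) z 0 (widen_ord (leqnSn n) i).

(* Omega is a bounded domain (open, connected, bounded) with Lipschitz boundary: near every
   boundary point x, in a rotated coordinate system centred at x, Omega is the region strictly
   below the graph of a Lipschitz function of the first n coordinates. *)
Definition lipschitz_domain {R : realType} {n : nat} (Omega : set 'rV[R]_n.+1) : Prop :=
  open Omega /\ connected Omega /\ bounded_set Omega /\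
  forall x, closure Omega x -> ~ Omega x ->
    exists r : R, 0 < r /\
    exists Q : 'M[R]_n.+1, Q *m Q^T = 1%:M /\
    exists g : 'rV[R]_n -> R, lipschitz_fun g /\
      forall y, enorm (y - x) < r ->
        (Omega y <-> let z := (y - x) *m Q in z 0 ord_max < g (first_coords z)).

(* A mesh: nE simplices, element e having vertices vtx e i (i : 'I_n.+2); nF (global) faces;
   the local face of element e opposite to its vertex j is the global face fidx e j. *)
Record mesh (R : realType) (n : nat) := Mesh {
  nE : nat;
  vtx : 'I_nE -> 'I_n.+2 -> 'rV[R]_n.+1;
  nF : nat;
  fidx : 'I_nE -> 'I_n.+2 -> 'I_nF }.

Arguments nE {R n} m : rename.
Arguments vtx {R n} m _ _ : rename.
Arguments nF {R n} m : rename.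
Arguments fidx {R n} m _ _ : rename.

Definition elem {R : realType} {n : nat} (M : mesh R n) (e : 'I_(nE M)) : set 'rV[R]_n.+1 :=
  hullset (vtx M e) [set: 'I_n.+2]%SET.
Definition lface {R : realType} {n : nat} (M : mesh R n) (e : 'I_(nE M)) (j : 'I_n.+2)
  : set 'rV[R]_n.+1 := hullset (vtx M e) [set~ j]%SET.
Definition fvtx {R : realType} {n : nat} (M : mesh R n) (e : 'I_(nE M)) (j : 'I_n.+2)
  (i : 'I_n.+1) : 'rV[R]_n.+1 := vtx M e (lift j i).

Definition conforming_mesh {R : realType} {n : nat} (Omega : set 'rV[R]_n.+1) (M : mesh R n)
  : Prop :=
  (forall e, \det (\matrix_(i < n.+1) (vtx M e (lift ord0 i) - vtx M e ord0)) != 0) /\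
  closure Omega = \bigcup_e elem M e /\
  (forall e1 e2, e1 != e2 -> interior (elem M e1) `&` interior (elem M e2) = set0) /\
  (forall e1 e2, e1 != e2 -> exists A : {set 'I_n.+2},
      elem M e1 `&` elem M e2 = hullset (vtx M e1) A /\
      forall i, i \in A -> exists i', vtx M e2 i' = vtx M e1 i) /\
  (forall f, exists e j, fidx M e j = f) /\
  (forall e j e' j', fidx M e j = fidx M e' j' <-> lface M e j = lface M e' j').

Definition hE {R : realType} {n : nat} (M : mesh R n) (e : 'I_(nE M)) : R :=
  sup [set r : R | exists2 x, elem M e x & exists2 y, elem M e y & r = enorm (x - y)].

Definition meshsize {R : realType} {n : nat} (M : mesh R n) : R :=
  \big[Num.max/0]_(e < nE M) hE M e.

Definition elemInt {R : realType} {n : nat} (M : mesh R n) (e : 'I_(nE M))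
  (g : 'rV[R]_n.+1 -> R) : R :=
  iint (fun x => (\1_(elem M e) x : R) * g x).

(* surface integral over the local face (e,j), via its affine parametrization by the
   reference n-simplex and the area factor sqrt(det (J J^T)) *)
Definition refsimplex {R : realType} {n : nat} : set 'rV[R]_n :=
  [set l | (forall i, 0 <= l 0 i) /\ \sum_i l 0 i <= 1].

Definition Jface {R : realType} {n : nat} (M : mesh R n) (e : 'I_(nE M)) (j : 'I_n.+2)
  : 'M[R]_(n, n.+1) :=
  \matrix_(i < n) (fvtx M e j (lift ord0 i) - fvtx M e j ord0).

Definition surfInt {R : realType} {n : nat} (M : mesh R n) (e : 'I_(nE M)) (j : 'I_n.+2)
  (g : 'rV[R]_n.+1 -> R) : R :=
  Num.sqrt (\det (Jface M e j *m (Jface M e j)^T)) *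
  iint (fun l : 'rV[R]_n => (\1_(@refsimplex R n) l : R) * g (fvtx M e j ord0 + l *m Jface M e j)).

Definition nrm {R : realType} {n : nat} (M : mesh R n) (e : 'I_(nE M)) (j : 'I_n.+2)
  : 'rV[R]_n.+1 :=
  xget 0 [set v | dotv v v = 1 /\
                  (forall i, dotv v (fvtx M e j i - fvtx M e j ord0) = 0) /\
                  dotv v (vtx M e j - fvtx M e j ord0) < 0].

(* the local faces (e,j) making up the global face f (two if f is interior, one if on the
   boundary) *)
Definition locs {R : realType} {n : nat} (M : mesh R n) (f : 'I_(nF M))
  : seq ('I_(nE M) * 'I_n.+2) :=
  [seq ej <- enum {: 'I_(nE M) * 'I_n.+2} | fidx M ej.1 ej.2 == f].

Definition interiorF {R : realType} {n : nat} (M : mesh R n) (f : 'I_(nF M)) : bool :=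
  (1 < size (locs M f))%N.

Definition faceset {R : realType} {n : nat} (M : mesh R n) (f : 'I_(nF M)) : set 'rV[R]_n.+1 :=
  [set x | exists e j, fidx M e j = f /\ lface M e j x].

(* integral over the global face f (all local faces of f are the same set, hence give the same
   surface integral; we average over them to avoid choosing one) *)
Definition faceInt {R : realType} {n : nat} (M : mesh R n) (f : 'I_(nF M))
  (g : 'rV[R]_n.+1 -> R) : R :=
  (size (locs M f))%:R^-1 * \sum_(ej <- locs M f) surfInt M ej.1 ej.2 g.

Notation poly R n := (mpoly.mpoly n.+1 R).

Definition degle {R : realType} {n : nat} (k : nat) (p : poly R n) : bool :=
  all (fun m => (mpoly.mdeg m <= k)%N) (mpoly.msupp p).

Definition ev {R : realType} {n : nat} (p : poly R n) (x : 'rV[R]_n.+1) : R :=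
  mpoly.meval (fun i => x 0 i) p.

Definition grad {R : realType} {n : nat} (p : poly R n) (x : 'rV[R]_n.+1) : 'rV[R]_n.+1 :=
  \row_i ev (mpoly.mderiv i p) x.

Definition kappa_ok {R : realType} {n : nat} (M : mesh R n) (kappa : 'I_(nE M) -> 'M[R]_n.+1)
  (kmin kmax : R) : Prop :=
  0 < kmin /\ kmin <= kmax /\
  forall e, (kappa e)^T = kappa e /\
    forall xi : 'rV[R]_n.+1,
      kmin * dotv xi xi <= dotv (xi *m kappa e) xi <= kmax * dotv xi xi.

Definition trace_const {R : realType} {n : nat} (M : mesh R n) (k : nat) (CT : R) : Prop :=
  0 < CT /\
  forall e j (w : poly R n), degle k w ->
    surfInt M e j (fun x => ev w x ^+ 2) <= CT ^+ 2 * (hE M e)^-1 * elemInt M e (fun x => ev w x ^+ 2).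

Definition tauEF {R : realType} {n : nat} (M : mesh R n) (kappa : 'I_(nE M) -> 'M[R]_n.+1)
  (alpha0 CT : R) (e : 'I_(nE M)) (j : 'I_n.+2) : R :=
  alpha0 * CT ^+ 2 * dotv (nrm M e j *m kappa e) (nrm M e j) * (hE M e)^-1.


(* V_h: an element of V_h is given by its polynomial on each element (u e = u|_E) *)
Definition Vh {R : realType} {n : nat} (M : mesh R n) := 'I_(nE M) -> poly R n.
(* hat V_h: a function on each (global) face; only its values on the face matter *)
Definition Vhat {R : realType} {n : nat} (M : mesh R n) := 'I_(nF M) -> 'rV[R]_n.+1 -> R.

Definition inVh {R : realType} {n : nat} (M : mesh R n) (k : nat) (u : Vh M) : Prop :=
  forall e, degle k (u e).

Definition inVhat {R : realType} {n : nat} (M : mesh R n) (k : nat) (uh : Vhat M) : Prop :=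
  forall f, (exists p : poly R n, degle k p /\ forall x, faceset M f x -> uh f x = ev p x) /\
            (~~ interiorF M f -> forall x, faceset M f x -> uh f x = 0).

Definition Veq {R : realType} {n : nat} (M : mesh R n) (u : Vh M) (uh : Vhat M)
  (w : Vh M) (wh : Vhat M) : Prop :=
  u = w /\ forall f x, faceset M f x -> uh f x = wh f x.

Definition kgrad {R : realType} {n : nat} (M : mesh R n) (kappa : 'I_(nE M) -> 'M[R]_n.+1)
  (u : Vh M) (e : 'I_(nE M)) (x : 'rV[R]_n.+1) : 'rV[R]_n.+1 :=
  (kappa e *m (grad (u e) x)^T)^T.

Definition volForm {R : realType} {n : nat} (M : mesh R n) (kappa : 'I_(nE M) -> 'M[R]_n.+1)
  (u v : Vh M) : R :=
  \sum_e elemInt M e (fun x => dotv (kgrad M kappa u e x) (grad (v e) x)).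

Definition rhs {R : realType} {n : nat} (M : mesh R n) (f : 'rV[R]_n.+1 -> R) (v : Vh M) : R :=
  \sum_e elemInt M e (fun x => f x * ev (v e) x).

(* tau : local face (e,j) |-> tau|_{E,F}; sigma(v) = - kappa grad_h v;
   hat sigma(u) = sigma(u) + tau [[u]];  [[(v, hat v)]]|_{E,F} = (v|_E - hat v) n_{E,F} *)
Definition aHIP {R : realType} {n : nat} (M : mesh R n) (kappa : 'I_(nE M) -> 'M[R]_n.+1)
  (tau : 'I_(nE M) -> 'I_n.+2 -> R) (eps : R) (u : Vh M) (uh : Vhat M) (v : Vh M) (vh : Vhat M)
  : R :=
  volForm M kappa u v +
  \sum_e \sum_j surfInt M e j (fun x =>
     dotv (- kgrad M kappa u e x + (tau e j * (ev (u e) x - uh (fidx M e j) x)) *: nrm M e j)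
          ((ev (v e) x - vh (fidx M e j) x) *: nrm M e j)) +
  eps * \sum_e \sum_j surfInt M e j (fun x =>
     dotv (- kgrad M kappa v e x) ((ev (u e) x - uh (fidx M e j) x) *: nrm M e j)).

Definition HIP_sol {R : realType} {n : nat} (M : mesh R n) (kappa : 'I_(nE M) -> 'M[R]_n.+1)
  (tau : 'I_(nE M) -> 'I_n.+2 -> R) (k : nat) (eps : R) (f : 'rV[R]_n.+1 -> R)
  (u : Vh M) (uh : Vhat M) : Prop :=
  inVh M k u /\ inVhat M k uh /\
  forall (v : Vh M) (vh : Vhat M), inVh M k v -> inVhat M k vh ->
    aHIP M kappa tau eps u uh v vh = rhs M f v.

Definition tsum {R : realType} {n : nat} (M : mesh R n) (tau : 'I_(nE M) -> 'I_n.+2 -> R)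
  (f : 'I_(nF M)) : R := \sum_(ej <- locs M f) tau ej.1 ej.2.

(* omega^tau_i = tau_i / (tau_1 + tau_2)  (= 1 on boundary faces) *)
Definition omega {R : realType} {n : nat} (M : mesh R n) (tau : 'I_(nE M) -> 'I_n.+2 -> R)
  (e : 'I_(nE M)) (j : 'I_n.+2) : R := tau e j / tsum M tau (fidx M e j).

Definition rho0 {R : realType} {n : nat} (M : mesh R n) (tau : 'I_(nE M) -> 'I_n.+2 -> R)
  (f : 'I_(nF M)) : R :=
  if interiorF M f then (\prod_(ej <- locs M f) tau ej.1 ej.2) / tsum M tau f else tsum M tau f.

Definition rho1 {R : realType} {n : nat} (M : mesh R n) (tau : 'I_(nE M) -> 'I_n.+2 -> R)
  (f : 'I_(nF M)) : R := (tsum M tau f)^-1.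

Definition jmp {R : realType} {n : nat} (M : mesh R n) (v : Vh M) (f : 'I_(nF M))
  (x : 'rV[R]_n.+1) : 'rV[R]_n.+1 :=
  \sum_(ej <- locs M f) ev (v ej.1) x *: nrm M ej.1 ej.2.

Definition wavg {R : realType} {n : nat} (M : mesh R n) (tau : 'I_(nE M) -> 'I_n.+2 -> R)
  (v : Vh M) (f : 'I_(nF M)) (x : 'rV[R]_n.+1) : R :=
  \sum_(ej <- locs M f) omega M tau ej.1 ej.2 * ev (v ej.1) x.

(* {kappa grad u}^*_omega = omega_2 b_1 + omega_1 b_2 on interior faces, b|_E on boundary faces *)
Definition kavgstar {R : realType} {n : nat} (M : mesh R n) (kappa : 'I_(nE M) -> 'M[R]_n.+1)
  (tau : 'I_(nE M) -> 'I_n.+2 -> R) (u : Vh M) (f : 'I_(nF M)) (x : 'rV[R]_n.+1)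
  : 'rV[R]_n.+1 :=
  if interiorF M f then
    \sum_(ej <- locs M f) (1 - omega M tau ej.1 ej.2) *: kgrad M kappa u ej.1 x
  else \sum_(ej <- locs M f) kgrad M kappa u ej.1 x.

Definition kjmp {R : realType} {n : nat} (M : mesh R n) (kappa : 'I_(nE M) -> 'M[R]_n.+1)
  (u : Vh M) (f : 'I_(nF M)) (x : 'rV[R]_n.+1) : R :=
  \sum_(ej <- locs M f) dotv (kgrad M kappa u ej.1 x) (nrm M ej.1 ej.2).

Definition acF {R : realType} {n : nat} (M : mesh R n) (kappa : 'I_(nE M) -> 'M[R]_n.+1)
  (tau : 'I_(nE M) -> 'I_n.+2 -> R) (u v : Vh M) : R :=
  - \sum_(f < nF M) faceInt M f (fun x => dotv (kavgstar M kappa tau u f x) (jmp M v f x)).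

Definition shF {R : realType} {n : nat} (M : mesh R n) (kappa : 'I_(nE M) -> 'M[R]_n.+1)
  (tau : 'I_(nE M) -> 'I_n.+2 -> R) (eps : R) (u v : Vh M) : R :=
  \sum_(f < nF M) faceInt M f (fun x => rho0 M tau f * dotv (jmp M u f x) (jmp M v f x)) -
  eps * \sum_(f < nF M | interiorF M f)
          faceInt M f (fun x => rho1 M tau f * kjmp M kappa u f x * kjmp M kappa v f x).

Definition aUIP {R : realType} {n : nat} (M : mesh R n) (kappa : 'I_(nE M) -> 'M[R]_n.+1)
  (tau : 'I_(nE M) -> 'I_n.+2 -> R) (eps : R) (u v : Vh M) : R :=
  volForm M kappa u v + acF M kappa tau u v + eps * acF M kappa tau v u +
  shF M kappa tau eps u v.

Definition UIP_sol {R : realType} {n : nat} (M : mesh R n) (kappa : 'I_(nE M) -> 'M[R]_n.+1)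
  (tau : 'I_(nE M) -> 'I_n.+2 -> R) (k : nat) (eps : R) (f : 'rV[R]_n.+1 -> R) (u : Vh M)
  : Prop :=
  inVh M k u /\ forall v : Vh M, inVh M k v -> aUIP M kappa tau eps u v = rhs M f v.

Definition hat_of {R : realType} {n : nat} (M : mesh R n) (kappa : 'I_(nE M) -> 'M[R]_n.+1)
  (tau : 'I_(nE M) -> 'I_n.+2 -> R) (u : Vh M) : Vhat M :=
  fun f x => if interiorF M f then wavg M tau u f x - rho1 M tau f * kjmp M kappa u f x else 0.

Definition HIP_unique {R : realType} {n : nat} (M : mesh R n) (kappa : 'I_(nE M) -> 'M[R]_n.+1)
  (tau : 'I_(nE M) -> 'I_n.+2 -> R) (k : nat) (eps : R) (f : 'rV[R]_n.+1 -> R) : Prop :=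
  exists (w : Vh M) (wh : Vhat M), HIP_sol M kappa tau k eps f w wh /\
    forall (w' : Vh M) (wh' : Vhat M), HIP_sol M kappa tau k eps f w' wh' -> Veq M w wh w' wh'.

(* Main.v *)
Require Import Defs.
From HB Require Import structures.
From mathcomp Require Import all_boot all_order all_fingroup all_algebra.
From mathcomp Require Import all_classical all_reals all_analysis.
From mathcomp Require Import measurable_realfun ring lra.
From mathcomp Require mpoly.
Import Order.TTheory GRing.Theory Num.Theory.
Import numFieldNormedType.Exports.
(* A plain import of mpoly would clash with the notations of MathComp-Analysis. *)
Import(canonicals) mpoly.
Local Open Scope classical_set_scope.
Local Open Scope ring_scope.

(** On every face the traces of the two adjacent elements see opposite normals, so the face
    terms of the H-IP form can be compared pointwise with those of the UIP-DG form: once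
    [hat u] is the conservative trace [{u}_omega - rho_1 [kappa grad u]], the numerical flux is
    single-valued, the trace [hat v] of the test function drops out, and the remaining face
    integrand is that of UIP-DG.  Conversely, testing an H-IP solution with [v = 0] and [hat v]
    supported on one interior face, equal there to the defect [q] of [hat u], gives
    [(tau_1 + tau_2) \int_F q^2 = 0], hence [hat u] is the conservative trace on that face.

    The geometric input is that a face is shared by at most two elements, with opposite
    normals, and that its surface integral does not depend on the order of the vertices.  The
    latter is needed for d = 2, 3 only, where the permutations of the reference simplex are
    generated by a reflection of the innermost variable and, for d = 3, Fubini's theorem. *)

(** * Polynomial functions *)

(** An inductive closure in any number of variables, so that continuity, boundedness and
    measurability follow by induction and pullbacks of mesh polynomials to the reference simplex of
    one dimension less stay in the class. *)
Inductive polyfun {R : realType} {m : nat} : ('rV[R]_m -> R) -> Prop :=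
| polyfun_cst c : polyfun (fun=> c)
| polyfun_coord i : polyfun (fun x => x 0 i)
| polyfunD f g : polyfun f -> polyfun g -> polyfun (fun x => f x + g x)
| polyfunM f g : polyfun f -> polyfun g -> polyfun (fun x => f x * g x).

Arguments polyfunD {R m f g}.
Arguments polyfunM {R m f g}.

Section PolyFun.
Context {R : realType} {m : nat}.
Implicit Types f g : 'rV[R]_m -> R.

Lemma eq_polyfun f g : f =1 g -> polyfun f -> polyfun g.
Proof. by move=> /funext ->. Qed.

Lemma polyfunN f : polyfun f -> polyfun (fun x => - f x).
Proof.
move=> pf; apply: eq_polyfun (polyfunM (polyfun_cst (-1)) pf) => x.
by rewrite mulN1r.
Qed.

Arguments polyfunN {f}.

Lemma polyfunB f g : polyfun f -> polyfun g -> polyfun (fun x => f x - g x).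
Proof. by move=> pf pg; apply: polyfunD pf (polyfunN pg). Qed.

Lemma polyfun_sum (I : Type) (r : seq I) (P : pred I) (F : I -> 'rV[R]_m -> R) :
  (forall i, polyfun (F i)) -> polyfun (fun x => \sum_(i <- r | P i) F i x).
Proof.
move=> pF; elim: r => [|i r IH].
  by apply: eq_polyfun (polyfun_cst 0) => x; rewrite big_nil.
case Pi : (P i); last by apply: eq_polyfun IH => x; rewrite big_cons Pi.
by apply: eq_polyfun (polyfunD (pF i) IH) => x; rewrite big_cons Pi.
Qed.

Lemma polyfun_prod (I : Type) (r : seq I) (P : pred I) (F : I -> 'rV[R]_m -> R) :
  (forall i, polyfun (F i)) -> polyfun (fun x => \prod_(i <- r | P i) F i x).
Proof.
move=> pF; elim: r => [|i r IH].
  by apply: eq_polyfun (polyfun_cst 1) => x; rewrite big_nil.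
case Pi : (P i); last by apply: eq_polyfun IH => x; rewrite big_cons Pi.
by apply: eq_polyfun (polyfunM (pF i) IH) => x; rewrite big_cons Pi.
Qed.

Lemma polyfunX f k : polyfun f -> polyfun (fun x => f x ^+ k).
Proof.
move=> pf; elim: k => [|k IH]; first exact: (polyfun_cst 1).
by apply: eq_polyfun (polyfunM pf IH) => x; rewrite exprS.
Qed.

Lemma polyfun_comp p f (phi : 'rV[R]_p -> 'rV[R]_m) :
  (forall i, polyfun (fun x => phi x 0 i)) -> polyfun f -> polyfun (fun x => f (phi x)).
Proof.
move=> pphi; elim=> [c|i|g h _ pg _ ph|g h _ pg _ ph]; [exact: polyfun_cst|exact: pphi| |].
  exact: polyfunD pg ph.
exact: polyfunM pg ph.
Qed.

Lemma polyfun_continuous_comp (T : topologicalType) (phi : T -> 'rV[R]_m) f :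
  (forall i, continuous (fun t => phi t 0 i)) -> polyfun f -> continuous (fun t => f (phi t)).
Proof.
move=> cphi; elim=> [c|i|g h _ pg _ ph|g h _ pg _ ph].
- exact: cst_continuous.
- exact: cphi.
- by move=> x; apply: continuousD; [apply: pg|apply: ph].
- by move=> x; apply: continuousM; [apply: pg|apply: ph].
Qed.

Lemma polyfun_continuous f : polyfun f -> continuous f.
Proof. by apply: polyfun_continuous_comp => i; exact: coord_continuous. Qed.

(** Induction over the generators; the unit cube is used because it contains the reference simplex
    in every dimension. *)
Lemma polyfun_bounded f : polyfun f ->
  exists C : R, forall x : 'rV[R]_m, (forall i, 0 <= x 0 i <= 1) -> `|f x| <= C.
Proof.
elim=> [c|i|g h _ [C pg] _ [D ph]|g h _ [C pg] _ [D ph]].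
- by exists `|c|.
- by exists 1 => x /(_ i) /andP[x0 x1]; rewrite ger0_norm.
- exists (C + D) => x bx.
  by rewrite (le_trans (ler_normD _ _))// lerD ?pg ?ph.
- by exists (C * D) => x bx; rewrite normrM ler_pM ?pg ?ph.
Qed.

Lemma polyfun_measurable d (T : measurableType d) (phi : T -> 'rV[R]_m) f :
  (forall i, measurable_fun setT (fun t => phi t 0 i)) -> polyfun f ->
  measurable_fun setT (fun t => f (phi t)).
Proof.
move=> mphi; elim=> [c|i|g h _ pg _ ph|g h _ pg _ ph]; [exact: measurable_cst|exact: mphi| |].
  exact: measurable_funD.
exact: measurable_funM.
Qed.

End PolyFun.

Lemma polyfun_ev {R : realType} {n : nat} (p : mpoly.mpoly n.+1 R) : polyfun (ev p).
Proof.
rewrite (_ : ev p = fun x => \sum_(m <- mpoly.msupp p)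
    mpoly.mcoeff m p * \prod_i x 0 i ^+ (mpoly.fun_of_multinom m i)).
  apply: polyfun_sum => m; apply: polyfunM; first exact: polyfun_cst.
  by apply: polyfun_prod => i; apply/polyfunX/polyfun_coord.
apply/funext => x; rewrite /ev mpoly.mevalE; exact: eq_bigr.
Qed.

(** * Integrals over the reference simplex *)

Section Integrability.
Context d {T : measurableType d} {R : realType}.

Lemma integrable_bounded_support (mu : {measure set T -> \bar R}) (D : set T) (g : T -> R)
    (C : R) :
  measurable D -> (mu D < +oo)%E -> measurable_fun setT g ->
  (forall x, D x -> `|g x| <= C) -> (forall x, ~ D x -> g x = 0) ->
  mu.-integrable setT (EFin \o g).
Proof.
move=> mD muD mg bg g0.
have -> : g = g \_ D.
  apply/funext => x; rewrite patchE; case: ifPn => // /negP xD.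
  by apply: g0 => Dx; apply: xD; rewrite inE.
rewrite -restrict_EFin; apply/(integrable_mkcond _ mD).
apply: measurable_bounded_integrable => //; first exact: measurable_funTS.
by exists C; split; [exact: num_real|move=> z Cz x Dx /=; rewrite (le_trans (bg x Dx))// ltW].
Qed.

Lemma measurable_ler_set (f g : T -> R) :
  measurable_fun setT f -> measurable_fun setT g -> measurable [set x | f x <= g x].
Proof.
move=> mf mg.
have mb : measurable [set true] by [].
by have := measurable_fun_ler mf mg measurableT mb; rewrite setTI.
Qed.

Lemma measurable_refsimplex n (phi : T -> 'rV[R]_n) :
  (forall i, measurable_fun setT (fun t => phi t 0 i)) -> measurable (phi @^-1` refsimplex).
Proof.
move=> mphi.
have -> : phi @^-1` refsimplex =
    (\bigcap_(i in [set: 'I_n]) [set t | 0 <= phi t 0 i]) `&` [set t | \sum_i phi t 0 i <= 1].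
  by apply/seteqP; split => [t [p0 p1]|t [p0 p1]]; split => // i; [move=> _|]; exact: p0.
apply: measurableI.
  apply: fin_bigcap_measurable; first exact: finite_finset.
  by move=> i _; apply: measurable_ler_set.
apply: measurable_ler_set => //.
exact: measurable_sum.
Qed.

End Integrability.

Definition sint {R : realType} {n : nat} (h : 'rV[R]_n -> R) : R :=
  iint (fun l => (\1_(@refsimplex R n) l : R) * h l).

(** A nested real-valued integral is additive only where every stage is integrable. The model
    replaces it, on polynomials, by one integral over a set [D] of finite measure. The clause
    producing [B] places a set of positive measure near every point of the simplex, which is what
    definiteness of the integral requires. *)
Definition simplex_model (R : realType) (n : nat) : Prop :=
  exists d (T : measurableType d) (mu : {measure set T -> \bar R}) (D : set T)
    (phi : T -> 'rV[R]_n),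
  [/\ measurable D /\ (mu D < +oo)%E,
      forall i, measurable_fun setT (fun t => phi t 0 i),
      forall t, D t -> refsimplex (phi t),
      forall x0 e, refsimplex x0 -> 0 < e -> exists B, [/\ measurable B, B `<=` D, (0 < mu B)%E &
        forall t, B t -> forall i, `|phi t 0 i - x0 0 i| < e] &
      forall h, polyfun h -> sint h = Rintegral mu D (fun t => h (phi t))].

(** * Coordinates on the reference segment and the reference triangle *)

Section Consrow.
Context {R : realType}.

Definition pt1 (t : R) : 'rV[R]_1 := consrow t 0.
Definition pt2 (z : R * R) : 'rV[R]_2 := consrow z.1 (consrow z.2 0).

Lemma pt1E t i : pt1 t 0 i = t.
Proof. by rewrite mxE (ord1 i) unlift_none. Qed.

Lemma pt2E0 z : pt2 z 0 ord0 = z.1.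
Proof. by rewrite mxE unlift_none. Qed.

Lemma pt2E1 z : pt2 z 0 (lift ord0 ord0) = z.2.
Proof. by rewrite mxE liftK mxE unlift_none. Qed.

Lemma ord2P (P : 'I_2 -> Prop) : P ord0 -> P (lift ord0 ord0) -> forall i, P i.
Proof. by move=> P0 P1 i; case: (unliftP ord0 i) => [j ->|->//]; rewrite (ord1 j). Qed.

Lemma refsimplex_pt1 t : refsimplex (pt1 t) <-> `[0, 1]%classic t.
Proof.
rewrite /refsimplex /= in_itv /= big_ord_recl big_ord0 addr0 pt1E.
split=> [[/(_ ord0)]|/andP[t0 t1]]; first by rewrite pt1E => -> ->.
by split=> // i; rewrite pt1E.
Qed.

Lemma refsimplex_pt2 z : refsimplex (pt2 z) <-> [/\ 0 <= z.1, 0 <= z.2 & z.1 + z.2 <= 1].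
Proof.
rewrite /refsimplex /= !big_ord_recl big_ord0 addr0 pt2E0 pt2E1.
split=> [[z0 z1]|[z0 z1 z2]]; last by split=> //; apply: ord2P; rewrite ?pt2E0 ?pt2E1.
by split=> //; [rewrite -(pt2E0 z)|rewrite -(pt2E1 z)].
Qed.

End Consrow.

Lemma refsimplex_le1 {R : realType} {n} (l : 'rV[R]_n) : refsimplex l -> forall i, 0 <= l 0 i <= 1.
Proof.
move=> [l0 l1] i; rewrite l0 /=; apply: le_trans l1.
by rewrite (bigD1 i)//= lerDl sumr_ge0.
Qed.

Lemma measurable_pt2 {R : realType} (i : 'I_2) :
  measurable_fun setT (fun z : measurableTypeR R * measurableTypeR R => pt2 z 0 i).
Proof.
move: i; apply: ord2P.
  by rewrite (_ : (fun z => _) = fst); [exact: measurable_fst|apply/funext => z; rewrite pt2E0].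
by rewrite (_ : (fun z => _) = snd); [exact: measurable_snd|apply/funext => z; rewrite pt2E1].
Qed.

(** * Reflection of the innermost variable of integration *)

Section Reflection.
Context {R : realType}.
Notation mu := (@lebesgue_measure R).

(** Substitution along the decreasing map [s |-> c - s] of slope -1; for negative [c] the interval
    is empty. *)
Lemma Rintegral_reflect (c : R) (G : R -> R) : continuous G ->
  Rintegral mu `[0, c]%classic (fun s => G (c - s)) = Rintegral mu `[0, c]%classic G.
Proof.
move=> cG; have [c0|c0] := ltP c 0.
  by rewrite set_itv_ge -?ltNge// !Rintegral_set0.
rewrite /Rintegral; congr fine.
pose F s := c - s.
have dF (s : R) : is_derive s 1 F (-1).
  by rewrite -[X in is_derive _ _ _ X]sub0r; apply: is_deriveB.
have F' : F^`()%classic = cst (-1) by apply/funext => s; rewrite derive1E derive_val.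
have := @integration_by_substitution_decreasing R F G 0 c c0.
rewrite /F subrr subr0 => ->.
- apply: eq_integral => s _; congr (_%:E).
  by rewrite -/F F' /= opprK mulr1.
- by move=> s t _ _; rewrite ltrD2l ltrN2.
- by rewrite -/F F' => s _; exact: cst_continuous.
- by rewrite -/F F'; exact: is_cvg_cst.
- by rewrite -/F F'; exact: is_cvg_cst.
- have cF : continuous F by move=> s; apply: differentiable_continuous; apply/derivable1_diffP.
  split; first by move=> s _.
    by apply: cvg_at_right_filter; exact: cF.
  by apply: cvg_at_left_filter; exact: cF.
- exact: continuous_subspaceT.
Qed.

Lemma continuous_pt1 i : continuous (fun t : R => pt1 t 0 i).
Proof.
by rewrite (_ : (fun t => _) = id) => [t|]; [exact: cvg_id|apply/funext => t; rewrite pt1E].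
Qed.

Lemma continuous_pt2r (t : R) i : continuous (fun s : R => pt2 (t, s) 0 i).
Proof.
move: i; apply: ord2P.
  by rewrite (_ : (fun s => _) = cst t); [exact: cst_continuous|apply/funext => s; rewrite pt2E0].
by rewrite (_ : (fun s => _) = id) => [s|]; [exact: cvg_id|apply/funext => s; rewrite pt2E1].
Qed.

Lemma sint_pt1 (h : 'rV[R]_1 -> R) :
  sint h = Rintegral mu `[0, 1]%classic (fun t => h (pt1 t)).
Proof.
rewrite /sint /= [RHS]Rintegral_mkcond; apply: eq_Rintegral => t _.
rewrite -/(pt1 t) patchE indicE.
have -> : (pt1 t \in refsimplex) = (t \in `[0, 1]%classic).
  by apply/idP/idP; rewrite !inE => /refsimplex_pt1.
by case: ifP => _; rewrite ?mul1r ?mul0r.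
Qed.

Lemma sint_reflect1 (h : 'rV[R]_1 -> R) : polyfun h ->
  sint (fun l : 'rV[R]_1 => h (pt1 (1 - l 0 ord0))) = sint h.
Proof.
move=> ph; rewrite !sint_pt1 -[RHS](Rintegral_reflect 1); last first.
  exact: polyfun_continuous_comp continuous_pt1 ph.
by apply: eq_Rintegral => t _; rewrite pt1E.
Qed.

(** For fixed first coordinate [t] the slice of the triangle is the interval from 0 to [1 - t], and
    the substitution reflects this interval onto itself. *)
Lemma sint_reflect2 (h : 'rV[R]_2 -> R) : polyfun h ->
  sint (fun l : 'rV[R]_2 => h (pt2 (l 0 ord0, 1 - l 0 ord0 - l 0 (lift ord0 ord0)))) = sint h.
Proof.
move=> ph; rewrite /sint /=; apply: eq_Rintegral => t _.
(* For [t < 0] the slice of the triangle is empty although the interval from 0 to [1 - t] is not, so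
   this case is separated. *)
have [t0|t0] := ltP t 0.
  have out s : (\1_(@refsimplex R 2) (consrow t (consrow s 0)) : R) = 0.
    rewrite indicE memNset// -[consrow _ _]/(pt2 (t, s)) => /refsimplex_pt2[/= t1 _ _].
    by move: t0; rewrite ltNge t1.
  by apply: eq_Rintegral => s _; rewrite !out !mul0r.
have inner (g : R -> R) : Rintegral mu setT
    (fun s => (\1_(@refsimplex R 2) (consrow t (consrow s 0)) : R) * g s) =
    Rintegral mu `[0, 1 - t]%classic g.
  rewrite [RHS]Rintegral_mkcond; apply: eq_Rintegral => s _.
  rewrite -[consrow _ _]/(pt2 (t, s)) patchE indicE.
  have -> : (pt2 (t, s) \in refsimplex) = (s \in `[0, 1 - t]%classic).
    apply/idP/idP; rewrite !inE.
      by move=> /refsimplex_pt2[/= _ s0 s1]; rewrite in_itv /= s0 lerBrDl.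
    by rewrite /= in_itv /= => /andP[s0 s1]; apply/refsimplex_pt2; split => //=; rewrite -lerBrDl.
  by case: ifP => _; rewrite ?mul1r ?mul0r.
rewrite !inner -[RHS]Rintegral_reflect.
  by apply: eq_Rintegral => s _; rewrite -[consrow t (consrow s 0)]/(pt2 (t, s)) pt2E0 pt2E1.
exact: polyfun_continuous_comp (continuous_pt2r t) ph.
Qed.

End Reflection.

Lemma simplex_model1 (R : realType) : simplex_model R 1.
Proof.
exists _, (measurableTypeR R), lebesgue_measure, `[0, 1]%classic, pt1; split.
- by split; [exact: measurable_itv|rewrite /= lebesgue_measure_itv/= lte01 -EFinB ltry].
- move=> i; rewrite (_ : (fun t => _) = id); first exact: measurable_id.
  by apply/funext => t; rewrite pt1E.
- by move=> t /refsimplex_pt1.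
- move=> x0 e rx0 e0; have /andP[x00 x01] := refsimplex_le1 _ rx0 ord0.
  (* The interval [[(1 - de) x, (1 - de) x + de]] is the image of the whole segment under the
     contraction of ratio [de] centred at [x]; hence it stays in the segment and within [e] of [x],
     even if [x] is an endpoint. *)
  pose de := Num.min 1 (e / 2).
  have de0 : 0 < de by rewrite lt_min ltr01 /=; lra.
  have de1 : de <= 1 by rewrite ge_min lexx.
  have dee : de <= e / 2 by rewrite ge_min lexx orbT.
  set x := x0 0 ord0 in x00 x01 *.
  pose y := (1 - de) * x.
  have y0 : 0 <= y by rewrite mulr_ge0//; lra.
  have dx0 : 0 <= de * x by rewrite mulr_ge0// ltW.
  have dx1 : de * x <= de by rewrite ler_piMr// ltW.
  have yE : y = x - de * x by rewrite /y; ring.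
  exists `[y, y + de]%classic; split.
  + exact: measurable_itv.
  + by move=> t /=; rewrite !in_itv /= => /andP[t1 t2]; apply/andP; split; nra.
  + by rewrite /= lebesgue_measure_itv/= lte_fin ifT ?lte_fin ?EFinB -?EFinB ?lte_fin; lra.
  + move=> t /=; rewrite in_itv /= => /andP[t1 t2] i; rewrite pt1E (ord1 i) -/x.
    rewrite ltr_norml; apply/andP; split; lra.
- by move=> h _; exact: sint_pt1.
Qed.

(** * Fubini's theorem on the reference triangle *)

Section Triangle.
Context {R : realType}.
Notation mu := (@lebesgue_measure R).
Notation T2 := (measurableTypeR R * measurableTypeR R)%type.
Let tri : set T2 := @pt2 R @^-1` refsimplex.
Let S := `[(0 : R), 1]%classic.

Let trg (h : 'rV[R]_2 -> R) (z : measurableTypeR R * measurableTypeR R) : R :=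
  \1_(@refsimplex R 2) (pt2 z) * h (pt2 z).

Let triangle_measurable :
  measurable tri.
Proof. apply: measurable_refsimplex; exact: measurable_pt2. Qed.

Let triangle_finite : ((mu \x mu)%E tri < +oo)%E.
Proof.
apply: (@le_lt_trans _ _ ((mu \x mu)%E (S `*` S))).
  apply: le_measure; rewrite ?inE//.
  - by apply: measurableX; exact: measurable_itv.
  - move=> z rz; have zb := refsimplex_le1 _ rz.
    by split; rewrite /S /= in_itv /=; [rewrite -(pt2E0 z)|rewrite -(pt2E1 z)].
rewrite product_measure1E; [|exact: measurable_itv|exact: measurable_itv].
by rewrite /S /= !lebesgue_measure_itv /= lte01 -EFinB -EFinM ltry.
Qed.

Let trg_measurable h : polyfun h -> measurable_fun setT (trg h).
Proof.
move=> ph; apply: measurable_funM; last exact: polyfun_measurable measurable_pt2 ph.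
rewrite (_ : (fun x => _) = \1_tri); first exact: measurable_indic.
by apply/funext => z; rewrite !indicE; congr (_%:R); apply/idP/idP; rewrite !inE.
Qed.

Let trg_out h z : ~ refsimplex (pt2 z) -> trg h z = 0.
Proof. by move=> rz; rewrite /trg indicE memNset ?mul0r. Qed.

Let trg_bounded h : polyfun h -> exists C : R, forall z, `|trg h z| <= C.
Proof.
move=> /polyfun_bounded[C bC]; exists C => z; have C0 : 0 <= C.
  by apply: le_trans (bC 0 _) => // i; rewrite mxE lexx ler01.
have [rz|rz] := pselect (refsimplex (pt2 z)); last by rewrite trg_out ?normr0.
by rewrite /trg indicE mem_set // mul1r bC //; exact: refsimplex_le1.
Qed.

Let trg_integrable h : polyfun h -> (mu \x mu)%E.-integrable setT (EFin \o trg h).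
Proof.
move=> ph; have [C bC] := trg_bounded _ ph.
apply: (@integrable_bounded_support _ T2 R (mu \x mu)%E tri (trg h) C) => //.
  exact: trg_measurable.
by move=> z; exact: trg_out.
Qed.

(** [sint] truncates each stage to a real number by [fine]. The inner and outer integrals are
    finite, so the truncations are harmless and the extended-real iterated integral of Fubini's
    theorem is recovered. *)
Let sint_iterated h : polyfun h ->
  (sint h)%:E = (\int[mu]_t \int[mu]_s (trg h (t, s))%:E)%E.
Proof.
move=> ph; have [C bC] := trg_bounded _ ph.
have fin_inner t : (\int[mu]_s (trg h (t, s))%:E)%E \is a fin_num.
  apply: integrable_fin_num => //.
  apply: (@integrable_bounded_support _ (measurableTypeR R) R mu S (fun s => trg h (t, s)) C) => //.
  - exact: measurable_itv.
  - by rewrite /S /= lebesgue_measure_itv /= lte01 -EFinB ltry.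
  - exact: measurableT_comp (trg_measurable _ ph) (measurable_pair1 _).
  - move=> s Ss; apply: trg_out => rz; apply: Ss.
    by have := refsimplex_le1 _ rz (lift ord0 ord0); rewrite pt2E1 /S /= in_itv.
have -> : sint h = Rintegral mu setT (fun t => Rintegral mu setT (fun s => trg h (t, s))).
  by [].
have -> : (\int[mu]_t \int[mu]_s (trg h (t, s))%:E =
    \int[mu]_t (Rintegral mu setT (fun s => trg h (t, s)))%:E)%E.
  by apply: eq_integral => t _; rewrite /Rintegral fineK.
rewrite [in LHS]/Rintegral fineK//.
rewrite (_ : (\int[mu]_t _)%E = (\int[mu]_t \int[mu]_s (trg h (t, s))%:E)%E); last first.
  by apply: eq_integral => t _; rewrite /Rintegral fineK.
rewrite (integral12_prod_meas1 (trg_integrable _ ph)).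
exact: integrable_fin_num (trg_integrable _ ph).
Qed.

Lemma simplex_model2 : simplex_model R 2.
Proof.
exists _, _, (mu \x mu)%E, tri, pt2; split.
- by split.
- exact: measurable_pt2.
- by [].
- move=> x0 e rx0 e0.
  have [x00 x01] := rx0.
  have := x00 (lift ord0 ord0); move: (x00 ord0) => {x00}.
  rewrite !big_ord_recl big_ord0 addr0 in x01; move: x01.
  set x := x0 0 ord0; set y := x0 0 (lift ord0 ord0) => xy1 x00 y00.
  (* The point is first contracted towards the origin by the factor [1 - de]. The slack gained below
     the hypotenuse is at least [de], which leaves room for a square of side [de / 2]. *)
  pose de := Num.min 1 (e / 2).
  have de0 : 0 < de by rewrite lt_min ltr01 /=; lra.
  have de1 : de <= 1 by rewrite ge_min lexx.
  have dee : de <= e / 2 by rewrite ge_min lexx orbT.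
  have dx0 : 0 <= de * x by rewrite mulr_ge0// ltW.
  have dy0 : 0 <= de * y by rewrite mulr_ge0// ltW.
  have dx1 : de * x <= de by rewrite ler_piMr//; lra.
  have dy1 : de * y <= de by rewrite ler_piMr//; lra.
  have dx : de * x <= x by rewrite ler_piMl//; lra.
  have dy : de * y <= y by rewrite ler_piMl//; lra.
  have dxy : 0 <= (1 - de) * (1 - x - y) by rewrite mulr_ge0//; lra.
  have dxyE : (1 - de) * (1 - x - y) = 1 - de - x - y + de * x + de * y by ring.
  exists (`[x - de * x, x - de * x + de / 2]%classic `*`
          `[y - de * y, y - de * y + de / 2]%classic); split.
  + by apply: measurableX; exact: measurable_itv.
  + move=> -[s t] /=; rewrite !in_itv /= => -[/andP[s0 s1] /andP[t0 t1]].
    by apply/refsimplex_pt2; split => /=; lra.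
  + apply: (@lt_le_trans _ _ ((mu \x mu)%E (`[x - de * x, x - de * x + de / 2]%classic `*`
          `[y - de * y, y - de * y + de / 2]%classic))); last by [].
    rewrite product_measure1E; [|exact: measurable_itv|exact: measurable_itv].
    have ltx : x - de * x < x - de * x + de / 2 by lra.
    have lty : y - de * y < y - de * y + de / 2 by lra.
    rewrite /= !lebesgue_measure_itv/= !lte_fin ltx lty.
    by rewrite -!EFinB -EFinM lte_fin mulr_gt0// subr_gt0.
  + move=> -[s t] /=; rewrite !in_itv /= => -[/andP[s0 s1] /andP[t0 t1]].
    by apply: ord2P; rewrite ?pt2E0 ?pt2E1 /= -/x -/y ltr_norml; apply/andP; split; lra.
- move=> h ph; apply: EFin_inj; rewrite sint_iterated//.
  rewrite (integral12_prod_meas1 (trg_integrable _ ph)).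
  have -> : Rintegral (mu \x mu)%E tri (fun t => h (pt2 t)) =
      Rintegral (mu \x mu)%E setT (trg h).
    rewrite Rintegral_mkcond; apply: eq_Rintegral => z _.
    rewrite patchE /trg indicE.
    have -> : (pt2 z \in refsimplex) = (z \in tri) by apply/idP/idP; rewrite !inE.
    by case: ifP => _; rewrite ?mul1r ?mul0r.
  rewrite /Rintegral fineK//.
  exact: integrable_fin_num (trg_integrable _ ph).
Qed.

(** Fubini's theorem exchanges the two integrations, and the reference triangle is symmetric in its
    coordinates. *)
Lemma sint_swap (h : 'rV[R]_2 -> R) :
  polyfun h -> sint (fun l : 'rV[R]_2 => h (pt2 (l 0 (lift ord0 ord0), l 0 ord0))) = sint h.
Proof.
move=> ph.
have psw : polyfun (fun l : 'rV[R]_2 => h (pt2 (l 0 (lift ord0 ord0), l 0 ord0))).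
  apply: polyfun_comp ph; apply: ord2P; [under eq_fun do rewrite pt2E0|
    under eq_fun do rewrite pt2E1]; exact: polyfun_coord.
apply: EFin_inj; rewrite (sint_iterated _ psw) (sint_iterated _ ph).
rewrite (Fubini (trg_integrable _ ph)).
apply: eq_integral => t _; apply: eq_integral => s _; congr (_%:E).
rewrite /trg pt2E0 pt2E1 /= !indicE.
suff -> : (pt2 (t, s) \in @refsimplex R 2) = (pt2 (s, t) \in @refsimplex R 2) by [].
by apply/idP/idP; rewrite !inE => /refsimplex_pt2[/= s0 t0 st];
  apply/refsimplex_pt2; split => //=; rewrite addrC.
Qed.

End Triangle.

(** * Linearity and definiteness of the integral of polynomials *)

Section SimplexIntegral.
Context {R : realType} {n : nat}.
Hypothesis model : simplex_model R n.
Implicit Types h g : 'rV[R]_n -> R.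

Let polyfun_integrable d (T : measurableType d) (mu : {measure set T -> \bar R}) (D : set T)
    (phi : T -> 'rV[R]_n) h :
  measurable D -> (mu D < +oo)%E -> (forall i, measurable_fun setT (fun t => phi t 0 i)) ->
  (forall t, D t -> refsimplex (phi t)) -> polyfun h ->
  mu.-integrable D (EFin \o (h \o phi)).
Proof.
move=> mD muD mphi Dphi ph; apply: measurable_bounded_integrable => //.
  by apply: measurable_funTS; exact: polyfun_measurable.
have [C bC] := polyfun_bounded _ ph.
exists C; split; [exact: num_real|move=> z Cz t Dt /=].
by rewrite (le_trans (bC _ _)) ?ltW//; apply: refsimplex_le1; exact: Dphi.
Qed.

Lemma sintD h g : polyfun h -> polyfun g -> sint (fun l => h l + g l) = sint h + sint g.
Proof.
move=> ph pg; have [d [T [mu [D [phi [[mD muD] mphi Dphi _ sE]]]]]] := model.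
rewrite !sE//; last exact: polyfunD.
by rewrite RintegralD//; exact: polyfun_integrable.
Qed.

Lemma sintZ c h : polyfun h -> sint (fun l => c * h l) = c * sint h.
Proof.
move=> ph; have [d [T [mu [D [phi [[mD muD] mphi Dphi _ sE]]]]]] := model.
rewrite !sE//; last exact: polyfunM (polyfun_cst _) ph.
by rewrite RintegralZl//; exact: polyfun_integrable.
Qed.

(** If [h] were positive at [l], it would be positive near [l] by continuity, hence on a set of
    positive measure supplied by the model; but a nonnegative function with zero integral vanishes
    almost everywhere. *)
Lemma sint_eq0 h : polyfun h -> (forall l, refsimplex l -> 0 <= h l) -> sint h = 0 ->
  forall l, refsimplex l -> h l = 0.
Proof.
move=> ph h0; have [d [T [mu [D [phi [[mD muD] mphi Dphi box sE]]]]]] := model.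
rewrite sE// => hint l rl; apply/eqP/negP => /negP hl0.
have hl : 0 < h l by rewrite lt_def hl0 h0.
have : \forall x \near l, 0 < h x.
  exact: (cvgr_gt (h l) (polyfun_continuous _ ph l) 0 hl).
move=> /nbhs_ballP[e /= e0 he].
have [B [mB BD muB Bl]] := box _ _ rl e0.
have hB t : B t -> 0 < h (phi t).
  move=> Bt; apply: he; rewrite -ball_normE /ball_ /=.
  rewrite [ltLHS]/Num.Def.normr /= mx_normrE; apply/bigmax_ltP; split => //= -[i j] _ /=.
  by rewrite (ord1 i) !mxE distrC; exact: Bl.
have intf := polyfun_integrable _ _ _ _ _ _ mD muD mphi Dphi ph.
have mf : measurable_fun D (EFin \o (h \o phi)) by have /integrableP[] := intf.
have int0 : (\int[mu]_(x in D) `|(EFin \o (h \o phi)) x| = 0)%E.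
  rewrite -[RHS]/(0%:E) -hint /Rintegral fineK; last exact: integrable_fin_num intf.
  by apply: eq_integral => t /[!inE] Dt /=; rewrite ger0_norm//; apply/h0/Dphi.
have /(ae_eq_integral_abs _ mD mf) [N [mN muN DN]] := int0.
have BN : B `<=` N.
  move=> t Bt; apply: DN => /= /(_ (BD _ Bt)) [] /eqP.
  by rewrite gt_eqF// hB.
have : (mu B <= mu N)%E by apply: le_measure; rewrite ?inE.
by rewrite muN leNgt muB.
Qed.

End SimplexIntegral.

(** * Affine parametrizations and permutations of the vertices *)

Section AffineParam.
Context {R : realType}.

Definition edges {n m} (p : 'I_n.+1 -> 'rV[R]_m) : 'M[R]_(n, m) :=
  \matrix_(i < n) (p (lift ord0 i) - p ord0).

Definition apar {n m} (p : 'I_n.+1 -> 'rV[R]_m) (l : 'rV[R]_n) : 'rV[R]_m :=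
  p ord0 + l *m edges p.

(** Barycentric coordinates with respect to the origin and the unit vectors; index [ord0] stands for
    the origin. *)
Definition bar {n} (l : 'rV[R]_n) (i : 'I_n.+1) : R :=
  if unlift ord0 i is Some j then l 0 j else 1 - \sum_j l 0 j.

Lemma bar0 n (l : 'rV[R]_n) : bar l ord0 = 1 - \sum_j l 0 j.
Proof. by rewrite /bar unlift_none. Qed.

Lemma barS n (l : 'rV[R]_n) i : bar l (lift ord0 i) = l 0 i.
Proof. by rewrite /bar liftK. Qed.

Lemma bar_sum n (l : 'rV[R]_n) : \sum_i bar l i = 1.
Proof.
rewrite big_ord_recl bar0; under [X in _ + X]eq_bigr do rewrite barS.
by rewrite subrK.
Qed.

Lemma bar_ge0 n (l : 'rV[R]_n) i : refsimplex l -> 0 <= bar l i.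
Proof.
move=> [l0 l1]; case: (unliftP ord0 i) => [j|] ->; first by rewrite barS.
by rewrite bar0 subr_ge0.
Qed.

Lemma aparE n m (p : 'I_n.+1 -> 'rV[R]_m) l : apar p l = \sum_i bar l i *: p i.
Proof.
rewrite big_ord_recl bar0 /apar mulmx_sum_row.
under eq_bigr do rewrite rowK scalerBr.
under [X in _ = _ + X]eq_bigr do rewrite barS.
by rewrite sumrB -scaler_suml scalerBl scale1r addrCA addrC.
Qed.

Lemma polyfun_mulmx n m (A : 'M[R]_(n, m)) i : polyfun (fun l : 'rV[R]_n => (l *m A) 0 i).
Proof.
under eq_fun do rewrite mxE.
by apply: polyfun_sum => j; apply: polyfunM (polyfun_coord j) (polyfun_cst _).
Qed.

Lemma polyfun_apar n m (p : 'I_n.+1 -> 'rV[R]_m) (g : 'rV[R]_m -> R) :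
  polyfun g -> polyfun (fun l => g (apar p l)).
Proof.
apply: polyfun_comp => i; under eq_fun do rewrite mxE.
exact: polyfunD (polyfun_cst _) (polyfun_mulmx _ _ _ _).
Qed.

(** The change of edges under a relabelling of the vertices. It does not depend on the vertices
    themselves, so its determinant can be computed on any convenient simplex. *)
Definition edge_perm {n} (s : 'S_n.+1) : 'M[R]_n :=
  \matrix_(i, k) ((s (lift ord0 i) == lift ord0 k)%:R - (s ord0 == lift ord0 k)%:R).

(** A permuted edge is the difference of two vectors issuing from [p ord0], each of which is an
    original edge or 0. *)
Lemma edges_perm n m (p : 'I_n.+1 -> 'rV[R]_m) (s : 'S_n.+1) :
  edges (p \o s) = edge_perm s *m edges p.
Proof.
have pE q : p q - p ord0 = \sum_k (q == lift ord0 k)%:R *: (p (lift ord0 k) - p ord0).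
  case: (unliftP ord0 q) => [j|] ->.
    rewrite (bigD1 j)//= eqxx scale1r big1 ?addr0// => k kj.
    by rewrite (inj_eq lift_inj) eq_sym (negbTE kj) scale0r.
  by rewrite subrr big1// => k _; rewrite (negbTE (neq_lift _ _)) scale0r.
apply/row_matrixP => i; rewrite row_mul rowK mulmx_sum_row.
rewrite [LHS](_ : _ = (p (s (lift ord0 i)) - p ord0) - (p (s ord0) - p ord0)); last first.
  by rewrite opprB addrA subrK.
rewrite !pE -sumrB; apply: eq_bigr => k _.
by rewrite rowK !mxE scalerBl.
Qed.

(** On the standard simplex the edge matrix is the identity, and exchanging the same two vertices
    twice restores it; hence the matrix of the exchange is an involution. *)
Lemma det_edge_tperm n (x y : 'I_n.+1) : \det (edge_perm (tperm x y)) ^+ 2 = 1 :> R.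
Proof.
pose p (i : 'I_n.+1) : 'rV[R]_n := if unlift ord0 i is Some k then delta_mx 0 k else 0.
have ep : edges p = 1%:M.
  by apply/row_matrixP => i; rewrite rowK row1 /p liftK unlift_none subr0.
have e1 : edges (p \o tperm x y) = edge_perm (tperm x y) by rewrite edges_perm ep mulmx1.
have : edges ((p \o tperm x y) \o tperm x y) = 1%:M.
  by rewrite -ep; congr edges; apply/funext => i /=; rewrite tpermK.
rewrite edges_perm e1 => /(congr1 determinant).
by rewrite det_mulmx det1 expr2.
Qed.

Definition fint {n m} (p : 'I_n.+1 -> 'rV[R]_m) (g : 'rV[R]_m -> R) : R :=
  Num.sqrt (\det (edges p *m (edges p)^T)) * sint (fun l => g (apar p l)).

(** The quantification over all vertex families is what makes the property stable under products of
    permutations. *)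
Definition fint_inv {n} (s : 'S_n.+1) := forall m (p : 'I_n.+1 -> 'rV[R]_m) g,
  polyfun g -> fint (p \o s) g = fint p g.

Lemma fint_invM n (s t : 'S_n.+1) : fint_inv s -> fint_inv t -> fint_inv (s * t)%g.
Proof.
move=> is_ it_ m p g pg; rewrite -(it_ _ p g pg) -(is_ _ (p \o t) g pg).
by congr fint; apply/funext => i /=; rewrite permM.
Qed.

(* exchanging two vertices amounts to the substitution [phi] of the reference simplex *)
Lemma fint_inv_tperm n (x y : 'I_n.+1) (phi : 'rV[R]_n -> 'rV[R]_n) :
  (forall h, polyfun h -> sint (fun l => h (phi l)) = sint h) ->
  (forall l i, bar (phi l) i = bar l (tperm x y i)) ->
  fint_inv (tperm x y).
Proof.
move=> sphi bphi m p g pg; rewrite /fint; congr (_ * _).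
  (* The Gram determinant is multiplied by the squared determinant of [edge_perm], which is 1. *)
  rewrite edges_perm trmx_mul mulmxA -(mulmxA _ (edges p)) !det_mulmx det_tr.
  by rewrite mulrAC -expr2 det_edge_tperm mul1r.
rewrite -(sphi _ (polyfun_apar _ _ p _ pg)); congr sint; apply/funext => l; congr g.
rewrite !aparE (reindex_inj (@perm_inj _ (tperm x y))).
by apply: eq_bigr => i _; rewrite bphi /= tpermK.
Qed.

Lemma fint_inv1 n : @fint_inv n 1%g.
Proof. by move=> m p g _; congr fint; apply/funext => i /=; rewrite perm1. Qed.

(** Every permutation is a product of transpositions. On the segment the only one is a reflection;
    on the triangle (0 2) is the reflection of the inner variable, (1 2) the exchange of
    coordinates, and (0 1) is a conjugate. *)
Lemma fint_perm n : (n = 1 \/ n = 2)%N -> forall s : 'S_n.+1, fint_inv s.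
Proof.
move=> n12 s; suff tp (x y : 'I_n.+1) : x != y -> fint_inv (tperm x y).
  have [ts -> /allP tsP] := prod_tpermP s.
  rewrite big_seq; apply: (big_ind fint_inv) => [||t /tsP]; [exact: fint_inv1| |exact: tp].
  by move=> u v; exact: fint_invM.
clear s; move: x y; case: n12 => ->.
  have t01 : fint_inv (tperm (ord0 : 'I_2) (lift ord0 ord0)).
    apply: (@fint_inv_tperm 1 ord0 (lift ord0 ord0) (fun l : 'rV[R]_1 => pt1 (1 - l 0 ord0))).
      exact: sint_reflect1.
    move=> l; apply: ord2P; rewrite ?tpermL ?tpermR !(bar0, barS) ?big_ord_recl ?big_ord0 !pt1E.
      by ring.
    by ring.
  elim/ord2P=> [] y; elim/ord2P: y => [] xy.
  - by exfalso; rewrite eqxx in xy.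
  - exact: t01.
  - by rewrite tpermC; exact: t01.
  - by exfalso; rewrite eqxx in xy.
set i1 : 'I_3 := lift ord0 ord0; set i2 : 'I_3 := lift ord0 (lift ord0 ord0).
have ord3P (P : 'I_3 -> Prop) : P ord0 -> P i1 -> P i2 -> forall i, P i.
  move=> P0 P1 P2 i; case: (unliftP ord0 i) => [j ->|->//]; move: j; exact: ord2P.
have t12 : fint_inv (tperm i1 i2).
  apply: (fint_inv_tperm _ _ _ (fun l : 'rV[R]_2 => pt2 (l 0 (lift ord0 ord0), l 0 ord0))).
    exact: sint_swap.
  move=> l; apply: ord3P; rewrite ?tpermL ?tpermR ?tpermD// !(bar0, barS).
  - by rewrite !big_ord_recl !big_ord0 pt2E0 pt2E1 /=; ring.
  - by rewrite pt2E0.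
  - by rewrite pt2E1.
have t02 : fint_inv (tperm ord0 i2).
  apply: (fint_inv_tperm _ _ _
    (fun l : 'rV[R]_2 => pt2 (l 0 ord0, 1 - l 0 ord0 - l 0 (lift ord0 ord0)))).
    exact: sint_reflect2.
  move=> l; apply: ord3P; rewrite ?tpermL ?tpermR ?tpermD// !(bar0, barS).
  - by rewrite !big_ord_recl !big_ord0 pt2E0 pt2E1 /=; ring.
  - by rewrite pt2E0.
  - by rewrite pt2E1 !big_ord_recl !big_ord0 /=; ring.
have t01 : fint_inv (tperm ord0 i1).
  have -> : tperm ord0 i1 = (tperm i1 i2 * (tperm ord0 i2 * tperm i1 i2))%g.
    have := tpermJ ord0 i2 (tperm i1 i2); rewrite tpermR tpermD// => <-.
    by rewrite /conjg tpermV.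
  exact: (fint_invM _ _ _ t12 (fint_invM _ _ _ t02 t12)).
elim/ord3P=> [] y; elim/ord3P: y => [] xy; try by exfalso; rewrite eqxx in xy.
- exact: t01.
- exact: t02.
- by rewrite tpermC; exact: t01.
- exact: t12.
- by rewrite tpermC; exact: t02.
- by rewrite tpermC; exact: t12.
Qed.

End AffineParam.

(** * Barycentric coordinates and facets of a simplex *)

Section Dotv.
Context {R : realType} {m : nat}.
Implicit Types a b c : 'rV[R]_m.

Lemma dotvE a b : dotv a b = \sum_i a 0 i * b 0 i.
Proof. by rewrite /dotv mxE; apply: eq_bigr => i _; rewrite mxE. Qed.

Lemma dotvC a b : dotv a b = dotv b a.
Proof. by rewrite !dotvE; apply: eq_bigr => i _; rewrite mulrC. Qed.

Lemma dotvDl a b c : dotv (a + b) c = dotv a c + dotv b c.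
Proof. by rewrite /dotv mulmxDl mxE. Qed.

Lemma dotvNl a c : dotv (- a) c = - dotv a c.
Proof. by rewrite /dotv mulNmx mxE. Qed.

Lemma dotvBl a b c : dotv (a - b) c = dotv a c - dotv b c.
Proof. by rewrite dotvDl dotvNl. Qed.

Lemma dotvZl x a b : dotv (x *: a) b = x * dotv a b.
Proof. by rewrite /dotv -scalemxAl mxE. Qed.

Lemma dotv0l a : dotv 0 a = 0.
Proof. by rewrite /dotv mul0mx mxE. Qed.

Lemma dotvDr a b c : dotv a (b + c) = dotv a b + dotv a c.
Proof. by rewrite !(dotvC a) dotvDl. Qed.

Lemma dotvNr a c : dotv a (- c) = - dotv a c.
Proof. by rewrite !(dotvC a) dotvNl. Qed.

Lemma dotvBr a b c : dotv a (b - c) = dotv a b - dotv a c.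
Proof. by rewrite dotvDr dotvNr. Qed.

Lemma dotvZr x a b : dotv a (x *: b) = x * dotv a b.
Proof. by rewrite !(dotvC a) dotvZl. Qed.

Lemma dotv0r a : dotv a 0 = 0.
Proof. by rewrite dotvC dotv0l. Qed.

Lemma dotv_sumr (I : Type) (r : seq I) (P : pred I) a (F : I -> 'rV[R]_m) :
  dotv a (\sum_(i <- r | P i) F i) = \sum_(i <- r | P i) dotv a (F i).
Proof. by apply: (big_morph (dotv a)) => [x y|]; rewrite ?dotvDr ?dotv0r. Qed.

Lemma dotv_ge0 a : 0 <= dotv a a.
Proof. by rewrite dotvE sumr_ge0// => i _; rewrite -expr2 sqr_ge0. Qed.

Lemma dotv_eq0 a : dotv a a = 0 -> a = 0.
Proof.
rewrite dotvE => /eqP; rewrite psumr_eq0; last by move=> i _; rewrite -expr2 sqr_ge0.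
move=> /allP a0; apply/rowP => i; rewrite mxE.
by have := a0 i; rewrite mem_index_enum => /(_ isT)/=; rewrite mulf_eq0 orbb => /eqP.
Qed.

End Dotv.

Section Barycentric.
Context {R : realType} {n : nat}.
Implicit Types (p q : 'I_n.+2 -> 'rV[R]_n.+1) (x y v u : 'rV[R]_n.+1) (j k : 'I_n.+2).

(** The inverse of the affine parametrization, followed by [bar]. In this form the coordinates are
    visibly polynomial in [x] and sum to 1 by construction. *)
Definition bcoord p x : 'I_n.+2 -> R := bar ((x - p ord0) *m invmx (edges p)).

Definition nondegenerate_simplex p := \det (edges p) != 0.

Lemma bcoord_sum p x : \sum_i bcoord p x i = 1.
Proof. exact: bar_sum. Qed.

Lemma polyfun_bcoord p i : polyfun (fun x => bcoord p x i).
Proof.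
have pl (k : 'I_n.+1) : polyfun (fun x => ((x - p ord0) *m invmx (edges p)) 0 k).
  apply: (@polyfun_comp _ _ _ (fun y => (y *m invmx (edges p)) 0 k)
    (fun x => x - p ord0)); last exact: polyfun_mulmx.
  move=> j; under eq_fun do rewrite mxE.
  exact: polyfunD (polyfun_coord _) (polyfun_cst _).
rewrite /bcoord; case: (unliftP ord0 i) => [k|] ->.
  by under eq_fun do rewrite barS; exact: pl.
under eq_fun do rewrite bar0.
by apply: polyfunB; [exact: polyfun_cst|exact: polyfun_sum].
Qed.

Section Nondegenerate.
Variable p : 'I_n.+2 -> 'rV[R]_n.+1.
Hypothesis pnd : nondegenerate_simplex p.

Let pU : edges p \in unitmx.
Proof. by rewrite unitmxE unitfE. Qed.

Lemma bcoordK x : x = \sum_i bcoord p x i *: p i.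
Proof. by rewrite -aparE /apar mulmxKV// addrC subrK. Qed.

Lemma bcoordE (w : 'I_n.+2 -> R) : \sum_i w i = 1 -> bcoord p (\sum_i w i *: p i) = w.
Proof.
move=> w1; pose l : 'rV[R]_n.+1 := \row_i w (lift ord0 i).
have bl : bar l = w.
  apply/funext => i; case: (unliftP ord0 i) => [j|] ->; first by rewrite barS mxE.
  rewrite bar0 -w1 big_ord_recl; under [X in _ - X]eq_bigr do rewrite mxE.
  by rewrite addrK.
have -> : \sum_i w i *: p i = apar p l by rewrite aparE bl.
by rewrite /bcoord /apar addrAC subrr add0r mulmxK.
Qed.

(** Expanding every [q k] in the vertices and exchanging the sums gives weights of total 1, and such
    weights are unique. *)
Lemma bcoord_affine m (w : 'I_m -> R) (q : 'I_m -> 'rV[R]_n.+1) i :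
  \sum_k w k = 1 ->
  bcoord p (\sum_k w k *: q k) i = \sum_k w k * bcoord p (q k) i.
Proof.
move=> w1.
have -> : \sum_k w k *: q k = \sum_j (\sum_k w k * bcoord p (q k) j) *: p j.
  under eq_bigr do rewrite [q _]bcoordK scaler_sumr.
  rewrite exchange_big; apply: eq_bigr => j _; rewrite scaler_suml.
  by apply: eq_bigr => k _; rewrite scalerA.
rewrite bcoordE// exchange_big -[RHS]w1; apply: eq_bigr => k _.
by rewrite -mulr_sumr bcoord_sum mulr1.
Qed.

Lemma bcoord_vtx k i : bcoord p (p k) i = (i == k)%:R.
Proof.
have {1}-> : p k = \sum_i (i == k)%:R *: p i.
  by rewrite (bigD1 k)//= eqxx scale1r big1 ?addr0// => j /negbTE->; rewrite scale0r.
by rewrite bcoordE// (bigD1 k)//= eqxx big1 ?addr0// => j /negbTE->.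
Qed.

Lemma hullsetP (A : {set 'I_n.+2}) x :
  hullset p A x <-> (forall i, 0 <= bcoord p x i) /\ (forall i, i \notin A -> bcoord p x i = 0).
Proof.
split=> [[w [w0 [wA [w1 ->]]]]|[b0 bA]]; first by rewrite bcoordE.
by exists (bcoord p x); split=> //; split=> //; split; [exact: bcoord_sum|exact: bcoordK].
Qed.

Lemma vtx_inj : injective p.
Proof.
move=> i j pij; have := bcoord_vtx i i; rewrite pij bcoord_vtx eqxx.
by case: eqP => // _ /eqP; rewrite eq_sym oner_eq0.
Qed.

Lemma hullset_vtx (A : {set 'I_n.+2}) k : k \in A -> hullset p A (p k).
Proof.
move=> kA; apply/hullsetP; split=> i; rewrite bcoord_vtx ?ler0n//.
by case: eqP => // -> /negP.
Qed.

Lemma bcoord_le1 (A : {set 'I_n.+2}) x i : hullset p A x -> bcoord p x i <= 1.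
Proof.
move=> /hullsetP[b0 _]; rewrite -(bcoord_sum p x) (bigD1 i)//= lerDl.
by rewrite sumr_ge0.
Qed.

Lemma bcoord1_vtx (A : {set 'I_n.+2}) x k : hullset p A x -> bcoord p x k = 1 -> x = p k.
Proof.
move=> /hullsetP[b0 _] bk; have := bcoord_sum p x; rewrite (bigD1 k)//= bk => /eqP.
rewrite -subr_eq0 addrAC subrr add0r psumr_eq0// => /allP bi.
rewrite [LHS]bcoordK (bigD1 k)//= bk scale1r big1 ?addr0// => i ik.
by have := bi i; rewrite mem_index_enum ik => /(_ isT)/= /eqP ->; rewrite scale0r.
Qed.

(** The finitely many barycentric coordinates are continuous, so they all remain positive in a
    neighbourhood of [x]. *)
Lemma interior_hullset x : (forall i, 0 < bcoord p x i) ->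
  interior (hullset p [set: 'I_n.+2]%SET) x.
Proof.
move=> b0; have : \forall y \near x, forall i, 0 < bcoord p y i.
  apply: (@filter_forall _ _ (fun i y => 0 < bcoord p y i) (nbhs x) (nbhs_filter x)) => i.
  exact: (cvgr_gt (bcoord p x i) (polyfun_continuous _ (polyfun_bcoord p i) x) 0 (b0 i)).
apply: filterS => y by0; apply/hullsetP; split=> i; last by rewrite inE.
exact: ltW.
Qed.

Lemma hullset_facet_inj j j' : hullset p [set~ j]%SET = hullset p [set~ j']%SET -> j = j'.
Proof.
move=> jj'; apply/eqP/negP => /negP nj.
have : hullset p [set~ j]%SET (p j') by apply: hullset_vtx; rewrite !inE eq_sym.
rewrite jj' => /hullsetP[_ /(_ j')]; rewrite !inE eqxx bcoord_vtx eqxx => /(_ isT)/eqP.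
by rewrite oner_eq0.
Qed.

Lemma bcoord_facet j (l : 'rV[R]_n) :
  bcoord p (apar (fun i : 'I_n.+1 => p (lift j i)) l) j = 0 /\
  forall i : 'I_n.+1, bcoord p (apar (fun i : 'I_n.+1 => p (lift j i)) l) (lift j i) = bar l i.
Proof.
pose w k := if unlift j k is Some i then bar l i else 0.
have wj : w j = 0 by rewrite /w unlift_none.
have wl i : w (lift j i) = bar l i by rewrite /w liftK.
have -> : apar (fun i : 'I_n.+1 => p (lift j i)) l = \sum_k w k *: p k.
  rewrite aparE (bigD1_ord j)//= wj scale0r add0r.
  by apply: eq_bigr => i _; rewrite wl.
have w1 : \sum_k w k = 1.
  by rewrite (bigD1_ord j)//= wj add0r -(bar_sum _ l); apply: eq_bigr => i _; rewrite wl.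
by rewrite bcoordE.
Qed.

Lemma facetP j x : hullset p [set~ j]%SET x <->
  exists2 l, refsimplex l & x = apar (fun i : 'I_n.+1 => p (lift j i)) l.
Proof.
split=> [/hullsetP[b0 bj]|[l rl ->]]; last first.
  have [lj ll] := bcoord_facet j l; apply/hullsetP; split=> i; last first.
    by rewrite !inE negbK => /eqP ->.
  by case: (unliftP j i) => [k|] ->; rewrite ?lj// ll; exact: bar_ge0.
have bj0 : bcoord p x j = 0 by apply: bj; rewrite !inE eqxx.
have := bcoord_sum p x; rewrite (bigD1_ord j)//= bj0 add0r => b1.
pose l : 'rV[R]_n := \row_i bcoord p x (lift j (lift ord0 i)).
have bl i : bar l i = bcoord p x (lift j i).
  case: (unliftP ord0 i) => [k|] ->; first by rewrite barS mxE.
  rewrite bar0 -b1 big_ord_recl; under [X in _ - X]eq_bigr do rewrite mxE.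
  by rewrite addrK.
exists l.
  split=> [i|]; first by rewrite mxE.
  by rewrite -subr_ge0 -bar0 bl.
rewrite aparE [LHS]bcoordK (bigD1_ord j)//= bj0 scale0r add0r.
by apply: eq_bigr => i _; rewrite bl.
Qed.

End Nondegenerate.

(** Vertices are the extreme points of a facet. A vertex of the second facet is a convex combination
    of vertices of the first; its own [q]-coordinate, equal to 1, is the corresponding mean of
    numbers at most 1, so a vertex of nonzero weight has coordinate 1 and coincides with it. *)
Lemma facet_vtx_perm p q j k : nondegenerate_simplex p -> nondegenerate_simplex q ->
  hullset p [set~ j]%SET = hullset q [set~ k]%SET ->
  exists s : 'S_n.+1, forall i, q (lift k i) = p (lift j (s i)).
Proof.
move=> pnd qnd pq.
have ex i : exists i', q (lift k i) = p (lift j i').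
  have qi : hullset q [set~ k]%SET (q (lift k i)).
    by apply: hullset_vtx => //; rewrite !inE eq_sym neq_lift.
  have /hullsetP-/(_ pnd)[b0 bj] : hullset p [set~ j]%SET (q (lift k i)) by rewrite pq.
  set b := bcoord p (q (lift k i)) in b0 bj.
  have bj0 : b j = 0 by apply: bj; rewrite !inE eqxx.
  have b1 : \sum_i b i = 1 by exact: bcoord_sum.
  pose c r := bcoord q (p (lift j r)) (lift k i).
  have pr r : hullset q [set~ k]%SET (p (lift j r)).
    by rewrite -pq; apply: hullset_vtx => //; rewrite !inE eq_sym neq_lift.
  have c1 r : c r <= 1 by exact: bcoord_le1 (pr r).
  (* The weights [b] have total 1, and by affinity so has the mean of the [c r]; all terms being
     nonnegative, each of them vanishes. *)
  have : \sum_r b (lift j r) * (1 - c r) == 0.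
    under eq_bigr do rewrite mulrBr mulr1.
    rewrite sumrB; move: (b1); rewrite (bigD1_ord j)//= bj0 add0r => ->.
    have := bcoord_affine q qnd _ b p (lift k i) b1.
    rewrite -bcoordK// bcoord_vtx// eqxx (bigD1_ord j)//= bj0 mul0r add0r => <-.
    by rewrite subrr.
  rewrite psumr_eq0 => [/allP bc|r _]; last by rewrite mulr_ge0// subr_ge0.
  have [r br] : exists r, b (lift j r) != 0.
    apply/existsP; apply: contraT => /existsPn bz; move: (b1).
    rewrite (bigD1_ord j)//= bj0 add0r big1 => [/eqP|r _]; first by rewrite eq_sym oner_eq0.
    by apply/eqP; move/negPn: (bz r).
  exists r; apply/esym/(bcoord1_vtx q qnd _ _ _ (pr r)).
  have := bc r; rewrite mem_index_enum => /(_ isT)/=.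
  by rewrite mulf_eq0 (negbTE br) /= subr_eq0 => /eqP.
have [f fP] := choice ex.
have finj : injective f.
  move=> i i' ff; apply: (@lift_inj _ k); apply: (vtx_inj q qnd).
  by rewrite !fP ff.
by exists (perm finj) => i; rewrite permE.
Qed.

(** If the vertex opposite to the common facet in [p] lies strictly on the inner side for [q], the
    barycentre of the facet can be moved slightly towards it, into the interior of both
    simplices. *)
Lemma facet_overlap p q j k (s : 'S_n.+1) : nondegenerate_simplex p -> nondegenerate_simplex q ->
  (forall i, q (lift k i) = p (lift j (s i))) -> 0 < bcoord q (p j) k ->
  exists x, (forall i, 0 < bcoord p x i) /\ (forall i, 0 < bcoord q x i).
Proof.
move=> pnd qnd qp bk.
(* [S] strictly dominates every negative [q]-coordinate of [p j]. The weight [t] on [p j] is tuned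
   so that each facet vertex gets weight [t * S]; the [q]-coordinates at the shared vertices are
   then [t] times [S] plus a coordinate of [p j], hence positive. *)
pose S := 1 + \sum_i `|bcoord q (p j) i|.
have S0 : 0 < S by rewrite ltr_pwDl// sumr_ge0.
have SP i : - bcoord q (p j) i < S.
  apply: (@le_lt_trans _ _ `|bcoord q (p j) i|); first by rewrite -normrN ler_norm.
  by rewrite /S (bigD1 i)//= addrCA ltrDl ltr_pwDl// sumr_ge0.
pose N : R := n.+1%:R.
have N0 : 0 < N by rewrite ltr0n.
have NS0 : 0 < 1 + N * S by rewrite ltr_pwDl// mulr_ge0// ltW.
pose t := (1 + N * S)^-1.
have t0 : 0 < t by rewrite invr_gt0.
have tE : (1 - t) / N = t * S.
  have e (a b : R) : a != 0 -> 1 + a * b != 0 -> (1 - (1 + a * b)^-1) / a = (1 + a * b)^-1 * b.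
    by move=> a0 ab0; field; rewrite ab0.
  by apply: e; rewrite gt_eqF.
pose w i := if i == j then t else (1 - t) / N.
have wj : w j = t by rewrite /w eqxx.
have wl i : w (lift j i) = (1 - t) / N by rewrite /w eq_sym (negbTE (neq_lift _ _)).
have w1 : \sum_i w i = 1.
  rewrite (bigD1_ord j)//= wj; under eq_bigr do rewrite wl.
  rewrite sumr_const card_ord -mulr_natr -/N -mulrA mulVf ?gt_eqF// mulr1.
  by rewrite addrC subrK.
exists (\sum_i w i *: p i); split=> i.
  rewrite bcoordE//; case: (unliftP j i) => [r|] ->; first by rewrite wl tE mulr_gt0.
  by rewrite wj.
rewrite bcoord_affine// (bigD1_ord j)//= wj.
rewrite (reindex_inj (@perm_inj _ s)) /=.
under eq_bigr do rewrite wl -qp bcoord_vtx//.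
rewrite -mulr_sumr tE; case: (unliftP k i) => [r|] ->.
  rewrite (bigD1 r)//= eqxx big1 ?addr0 => [|u ur]; last first.
    by rewrite (inj_eq lift_inj) eq_sym (negbTE ur).
  by rewrite mulr1 -mulrDr mulr_gt0// -ltrBlDl sub0r.
rewrite big1 ?mulr0 ?addr0 ?mulr_gt0// => u _.
by rewrite (negbTE (neq_lift _ _)).
Qed.

Definition facet_normal p (j : 'I_n.+2) : set 'rV[R]_n.+1 :=
  [set v | dotv v v = 1 /\
    (forall i, dotv v (p (lift j i) - p (lift j ord0)) = 0) /\
    dotv v (p j - p (lift j ord0)) < 0].

(** In the barycentric expansion of [x] all vertices of the facet contribute 0, and only the
    opposite vertex remains. *)
Lemma dotv_facet_normal p j v x : nondegenerate_simplex p -> facet_normal p j v ->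
  dotv v (x - p (lift j ord0)) = bcoord p x j * dotv v (p j - p (lift j ord0)).
Proof.
move=> pnd [_ [v0 _]].
have -> : x - p (lift j ord0) = \sum_i bcoord p x i *: (p i - p (lift j ord0)).
  under eq_bigr do rewrite scalerBr.
  by rewrite sumrB -scaler_suml bcoord_sum scale1r -bcoordK.
rewrite dotv_sumr (bigD1_ord j)//= dotvZr big1 ?addr0// => i _.
by rewrite dotvZr v0 mulr0.
Qed.

(** The outward normal is minus the normalized gradient of the barycentric coordinate of index
    [j]. *)
Lemma facet_normal_ex p j : nondegenerate_simplex p -> exists v, facet_normal p j v.
Proof.
move=> pnd.
(* [c] is the linear part of [bar] at index [j], so that [a] is the gradient of that barycentric
   coordinate in [x]. *)
pose c : 'cV[R]_n.+1 := \col_k ((j == lift ord0 k)%:R - (j == ord0)%:R).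
pose a : 'rV[R]_n.+1 := (invmx (edges p) *m c)^T.
have aE x y : dotv a (x - y) = bcoord p x j - bcoord p y j.
  rewrite dotvC /dotv trmxK mulmxA.
  rewrite (_ : x - y = (x - p ord0) - (y - p ord0)); last by rewrite opprB addrA subrK.
  rewrite mulmxBl mulmxBl mxE [X in _ + X]mxE /bcoord.
  have barE (l : 'rV[R]_n.+1) : (l *m c) 0 0 = bar l j - (j == ord0)%:R.
    rewrite mxE; under eq_bigr do rewrite mxE mulrBr.
    have l0 (i : 'I_n.+1) : (ord0 == lift ord0 i) = false by exact: negbTE (neq_lift _ _).
    case: (unliftP ord0 j) => [k|] jE; rewrite jE ?barS ?bar0 sumrB.
      rewrite eq_sym l0 subr0 [X in _ - X]big1 ?subr0; last by move=> i _; rewrite mulr0.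
      rewrite (bigD1 k)//= eqxx mulr1 big1 ?addr0// => i ik.
      by rewrite (inj_eq lift_inj) eq_sym (negbTE ik) mulr0.
    rewrite big1; last by move=> i _; rewrite l0 mulr0.
    rewrite eqxx sub0r addrAC subrr add0r; congr (- _).
    by apply: eq_bigr => i _; rewrite mulr1.
  by rewrite !barE opprB addrA subrK.
have aj : dotv a (p j - p (lift j ord0)) = 1.
  by rewrite aE !bcoord_vtx// eqxx (negbTE (neq_lift _ _)) subr0.
have a0 : 0 < dotv a a.
  rewrite lt_def dotv_ge0 andbT; apply/eqP => /dotv_eq0 a0.
  by move: aj; rewrite a0 dotv0l => /eqP; rewrite eq_sym oner_eq0.
pose r := (Num.sqrt (dotv a a))^-1.
have r0 : 0 < r by rewrite invr_gt0 sqrtr_gt0.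
exists (- (r *: a)); split; [|split].
- rewrite dotvNl dotvNr opprK dotvZl dotvZr mulrA -expr2 exprVn sqr_sqrtr ?ltW//.
  by rewrite mulVf// gt_eqF.
- move=> i; rewrite dotvNl dotvZl aE !bcoord_vtx// !(negbTE (neq_lift _ _)) subrr.
  by rewrite mulr0 oppr0.
- by rewrite dotvNl dotvZl aj mulr1 oppr_lt0.
Qed.

(** Both vectors are normal to the same facet, hence proportional. The ratio is fixed by the
    opposite vertex [p j]: it lies on the inner side for [v] and, by the sign condition, not on the
    inner side for [u]. The ratio is thus nonpositive, and unit length makes it -1. *)
Lemma facet_normal_opp p q j k (s : 'S_n.+1) v u :
  nondegenerate_simplex p -> nondegenerate_simplex q ->
  (forall i, q (lift k i) = p (lift j (s i))) ->
  facet_normal p j v -> facet_normal q k u -> bcoord q (p j) k <= 0 -> u = - v.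
Proof.
move=> pnd qnd qp vN uN bk.
have [v1 [v0 vj]] := vN; have [u1 [u0 uk]] := uN.
have u0' i i' : dotv u (p (lift j i) - p (lift j i')) = 0.
  have qE r : p (lift j r) - q (lift k ord0) = q (lift k (s^-1%g r)) - q (lift k ord0).
    by rewrite (qp (s^-1%g r)) permKV.
  rewrite -(subrK (q (lift k ord0)) (p (lift j i))) -addrA -(opprB (p _)) dotvBr !qE.
  by rewrite !u0 subrr.
set D1 := dotv v (p j - p (lift j ord0)) in vj.
pose D2 := dotv u (p j - p (lift j ord0)).
have D2E : D2 = bcoord q (p j) k * dotv u (q k - q (lift k ord0)).
  rewrite -dotv_facet_normal// /D2 (qp ord0).
  rewrite (_ : p j - p (lift j (s ord0)) =
    (p j - p (lift j ord0)) + (p (lift j ord0) - p (lift j (s ord0)))); last first.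
    by rewrite addrA subrK.
  by rewrite [RHS]dotvDr u0' addr0.
have D20 : 0 <= D2 by rewrite D2E mulr_le0// ltW.
have prop : D1 *: u = D2 *: v.
  (* The difference is orthogonal to the facet and, by the choice of factors, to the direction of
     [p j]. These directions span the space, so it is orthogonal to itself. *)
  apply/eqP; rewrite -subr_eq0; apply/eqP; set w := _ - _.
  have wx x : dotv w (x - p (lift j ord0)) = 0.
    rewrite [x](bcoordK p pnd) -[X in _ - X]scale1r -(bcoord_sum p x) scaler_suml -sumrB.
    rewrite dotv_sumr (bigD1_ord j)//= -scalerBr dotvZr /w dotvBl !dotvZl -/D1 -/D2.
    rewrite (mulrC D2) subrr mulr0 add0r big1// => i _.
    by rewrite -scalerBr dotvZr dotvBl !dotvZl u0' v0 !mulr0 subr0 mulr0.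
  by apply: dotv_eq0; have := wx (w + p (lift j ord0)); rewrite addrK.
have uE : u = (D2 / D1) *: v.
  by rewrite mulrC -scalerA -prop scalerA mulVf ?scale1r// lt_eqF.
have l0 : D2 / D1 <= 0 by rewrite mulr_ge0_le0// invr_le0 ltW.
have : (D2 / D1) ^+ 2 = 1 by rewrite -u1 uE dotvZl dotvZr v1 mulr1 expr2.
move=> /eqP; rewrite sqrf_eq1 => /orP[/eqP l1|/eqP l1].
  by move: l0; rewrite l1 ler10.
by rewrite uE l1 scaleN1r.
Qed.

(** Adjoining the unit normal as a row gives a square matrix whose squared determinant is the Gram
    determinant, which is therefore nonnegative. It is nonzero because the edges of a facet are
    linearly independent. *)
Lemma facet_gram_gt0 p j : nondegenerate_simplex p ->
  0 < \det (edges (fun i : 'I_n.+1 => p (lift j i)) *m (edges (fun i : 'I_n.+1 => p (lift j i)))^T).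
Proof.
move=> pnd; set J := edges _; have [v [v1 [v0 _]]] := facet_normal_ex p j pnd.
have vJ : v *m J^T = 0.
  apply/rowP => i; rewrite !mxE; have := v0 (lift ord0 i); rewrite dotvE => vi.
  by rewrite -[RHS]vi; apply: eq_bigr => k _; rewrite !mxE.
pose B : 'M[R]_(1 + n, n.+1) := col_mx v J.
have BB : \det (B *m B^T) = \det (J *m J^T).
  rewrite tr_col_mx mul_col_row vJ -(trmxK (J *m v^T)) trmx_mul trmxK vJ trmx0 det_ublock.
  rewrite (_ : v *m v^T = 1%:M) ?det1 ?mul1r//.
  by apply/rowP => i; rewrite (ord1 i) [LHS]v1 mxE.
have gramE : \det (J *m J^T) = \det (B : 'M[R]_n.+1) ^+ 2.
  by rewrite -BB expr2 -[X in _ * X]det_tr -det_mulmx.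
have J0 : 0 <= \det (J *m J^T) by rewrite gramE sqr_ge0.
rewrite lt_def J0 andbT; apply/det0P => -[w w0 wJ].
have wJ0 : w *m J = 0.
  by apply: dotv_eq0; rewrite /dotv trmx_mul mulmxA -(mulmxA w) wJ mul0mx mxE.
(* Since [w] kills the edges, it parametrizes the base vertex of the facet, whose remaining
   barycentric coordinates are 0; they are the entries of [w]. *)
have [_ bw] := bcoord_facet p pnd j w.
case/eqP: w0; apply/rowP => i; rewrite -barS -bw /apar -/J wJ0 addr0 bcoord_vtx//.
by rewrite (inj_eq lift_inj) eq_sym (negbTE (neq_lift _ _)) mxE.
Qed.

End Barycentric.

(** * Faces of a conforming mesh *)

Lemma eq_sint {R : realType} {n} (h g : 'rV[R]_n -> R) :
  (forall l, refsimplex l -> h l = g l) -> sint h = sint g.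
Proof.
move=> hg; congr iint; apply/funext => l; rewrite indicE.
by have [rl|rl] := boolP (l \in refsimplex); rewrite ?mul0r// hg// -in_setE.
Qed.

(** Proved for arbitrary integrands, so that it also covers volume integrals containing the source
    term. *)
Lemma iint0 {R : realType} {m} (h : 'rV[R]_m -> R) : (forall x, h x = 0) -> iint h = 0.
Proof.
elim: m h => [|m IH] h h0 /=; first exact: h0.
under eq_Rintegral => t _ do rewrite IH//.
by rewrite /Rintegral integral0.
Qed.

Lemma iint_ge0 {R : realType} {m} (h : 'rV[R]_m -> R) : (forall x, 0 <= h x) -> 0 <= iint h.
Proof. by elim: m h => [|m IH] h h0 /=; [exact: h0|apply: Rintegral_ge0 => t _; exact: IH]. Qed.

(** * Degree bounds and evaluation of polynomials *)

Section Degree.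
Context {R : realType} {n : nat}.
Implicit Types p q : Defs.poly R n.

Lemma degleP k p :
  reflect (forall m, mpoly.mcoeff m p != 0 -> (mpoly.mdeg m <= k)%N) (degle k p).
Proof.
rewrite /degle; apply/(iffP idP) => [/allP pk m|pk].
  by rewrite -mpoly.mcoeff_msupp; exact: pk.
by apply/allP => m; rewrite mpoly.mcoeff_msupp; exact: pk.
Qed.

Lemma degle0 k : degle k (0 : Defs.poly R n).
Proof. by apply/degleP => m; rewrite mpoly.mcoeff0 eqxx. Qed.

Lemma degle1 k : degle k (1 : Defs.poly R n).
Proof.
apply/degleP => m; rewrite mpoly.mcoeff1.
by have [->|_] := eqVneq m; rewrite ?eqxx// mpoly.mdeg0.
Qed.

Lemma degleD k p q : degle k p -> degle k q -> degle k (p + q).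
Proof.
move=> /degleP pk /degleP qk; apply/degleP => m; rewrite mpoly.mcoeffD.
have [p0|pn0 _] := eqVneq (mpoly.mcoeff m p) 0; last exact: pk.
by rewrite p0 add0r; exact: qk.
Qed.

Lemma degleZ k c p : degle k p -> degle k (c *: p).
Proof.
move=> /degleP pk; apply/degleP => m; rewrite mpoly.mcoeffZ mulf_eq0 negb_or => /andP[_].
exact: pk.
Qed.

Lemma degleB k p q : degle k p -> degle k q -> degle k (p - q).
Proof. by move=> pk qk; apply: degleD => //; rewrite -scaleN1r; exact: degleZ. Qed.

Lemma degle_sum k (I : Type) (r : seq I) (P : pred I) (F : I -> Defs.poly R n) :
  (forall i, degle k (F i)) -> degle k (\sum_(i <- r | P i) F i).
Proof.
move=> Fk; apply: (big_ind (fun p => degle k p)) => //; [exact: degle0|].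
by move=> p q; exact: degleD.
Qed.

Lemma degle_mderiv k i p : degle k p -> degle k (mpoly.mderiv i p).
Proof.
move=> /degleP pk; apply/degleP => m; rewrite mpoly.mcoeff_deriv => pm.
have /pk : mpoly.mcoeff (mpoly.mnm_add m (mpoly.mnm1 i)) p != 0.
  by apply: contraNneq pm => ->; rewrite mul0rn.
by apply: leq_trans; rewrite mpoly.mdegD leq_addr.
Qed.

Lemma ev0 x : ev (0 : Defs.poly R n) x = 0.
Proof. exact: mpoly.meval0. Qed.

Lemma ev1 x : ev (1 : Defs.poly R n) x = 1.
Proof. exact: mpoly.meval1. Qed.

Lemma evB p q x : ev (p - q) x = ev p x - ev q x.
Proof. exact: mpoly.mevalB. Qed.

Lemma evZ c p x : ev (c *: p) x = c * ev p x.
Proof. exact: mpoly.mevalZ. Qed.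

Lemma ev_sum (I : Type) (r : seq I) (P : pred I) (F : I -> Defs.poly R n) x :
  ev (\sum_(i <- r | P i) F i) x = \sum_(i <- r | P i) ev (F i) x.
Proof.
by apply: (big_morph (fun p => ev p x)) => [p q|]; [exact: mpoly.mevalD|exact: ev0].
Qed.

Lemma grad0 x : grad (0 : Defs.poly R n) x = 0.
Proof. by apply/rowP => i; rewrite !mxE mpoly.mderiv0 ev0. Qed.

End Degree.

Lemma polyfun_dotv {R : realType} {m r} (F G : 'rV[R]_m -> 'rV[R]_r) :
  (forall i, polyfun (fun x => F x 0 i)) -> (forall i, polyfun (fun x => G x 0 i)) ->
  polyfun (fun x => dotv (F x) (G x)).
Proof.
move=> pF pG; under eq_fun do rewrite dotvE.
by apply: polyfun_sum => i; apply: polyfunM.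
Qed.

Section Mesh.
Context {R : realType} {n : nat} (M : mesh R n).
Implicit Types (e : 'I_(nE M)) (j : 'I_n.+2) (f : 'I_(nF M)) (g h : 'rV[R]_n.+1 -> R).

Lemma surfIntE e j g : surfInt M e j g = fint (fun i : 'I_n.+1 => vtx M e (lift j i)) g.
Proof. by []. Qed.

Lemma mem_locs f ej : (ej \in locs M f) = (fidx M ej.1 ej.2 == f).
Proof. by rewrite mem_filter mem_enum andbT. Qed.

Lemma locs_uniq f : uniq (locs M f).
Proof. exact/filter_uniq/enum_uniq. Qed.

Lemma sum_local_faces (G : 'I_(nE M) -> 'I_n.+2 -> R) :
  \sum_e \sum_j G e j = \sum_f \sum_(ej <- locs M f) G ej.1 ej.2.
Proof.
rewrite pair_big /= (partition_big (fun ej => fidx M ej.1 ej.2) xpredT)//=.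
by apply: eq_bigr => f _; rewrite big_filter big_enum_cond.
Qed.

(** * Orientation and surface integrals of shared faces *)

Section Conforming.
Variable Omega : set 'rV[R]_n.+1.
Hypothesis conf : conforming_mesh Omega M.
Hypothesis n12 : (n = 1 \/ n = 2)%N.

Lemma vtx_nondegenerate e : nondegenerate_simplex (vtx M e).
Proof. by case: conf => /(_ e). Qed.

Lemma simplex_model12 : simplex_model R n.
Proof. by case: n12 => ->; [exact: simplex_model1|exact: simplex_model2]. Qed.

Lemma nrm_facet_normal e j : facet_normal (vtx M e) j (nrm M e j).
Proof. exact: xgetPex (facet_normal_ex _ j (vtx_nondegenerate e)). Qed.

Lemma dotv_nrm e j : dotv (nrm M e j) (nrm M e j) = 1.
Proof. by case: (nrm_facet_normal e j). Qed.

Lemma fidx_lface e j e' j' : fidx M e j = fidx M e' j' -> lface M e j = lface M e' j'.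
Proof. by case: conf => _ [_ [_ [_ [_ /(_ e j e' j')[]]]]]. Qed.

(** Two facets of one element are different sets, so the elements differ. If the vertex opposite to
    the common facet in one lay strictly on the inner side for the other, their interiors would
    meet. *)
Lemma nrm_shared e j e' j' : fidx M e j = fidx M e' j' -> (e, j) != (e', j') ->
  nrm M e' j' = - nrm M e j.
Proof.
move=> /fidx_lface jj' ne.
have nd := vtx_nondegenerate.
have ee' : e != e'.
  apply: contraNneq ne => ee'; rewrite -ee' in jj' *.
  by rewrite (hullset_facet_inj _ (nd e) _ _ jj').
have [s sP] := facet_vtx_perm _ _ _ _ (nd e) (nd e') jj'.
apply: (facet_normal_opp _ _ _ _ _ _ _ (nd e) (nd e') sP); try exact: nrm_facet_normal.
rewrite leNgt; apply/negP => /(facet_overlap _ _ _ _ _ (nd e) (nd e') sP)[x [x1 x2]].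
have [_ [_ [disj _]]] := conf.
suff : (interior (elem M e) `&` interior (elem M e')) x by rewrite disj.
by split; apply: interior_hullset.
Qed.

Variant locs_spec f : seq ('I_(nE M) * 'I_n.+2) -> bool -> Prop :=
| LocsBoundary a of fidx M a.1 a.2 = f : locs_spec f [:: a] false
| LocsInterior a b of fidx M a.1 a.2 = f & fidx M b.1 b.2 = f &
    nrm M b.1 b.2 = - nrm M a.1 a.2 : locs_spec f [:: a; b] true.

Lemma locsP f : locs_spec f (locs M f) (interiorF M f).
Proof.
rewrite /interiorF.
have locE ej : ej \in locs M f -> fidx M ej.1 ej.2 = f by rewrite mem_locs => /eqP.
have opp a b : a \in locs M f -> b \in locs M f -> a != b -> nrm M b.1 b.2 = - nrm M a.1 a.2.
  move=> /locE fa /locE fb ab; apply: nrm_shared; first by rewrite fa fb.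
  by rewrite -!surjective_pairing.
have ne : locs M f <> [::].
  move=> noloc; have [_ [_ [_ [_ [/(_ f)[e [j fej]] _]]]]] := conf.
  by have := mem_locs f (e, j); rewrite noloc /= fej eqxx.
case: (locs M f) (locs_uniq f) locE opp ne => [|a [|b [|c s]]] /=.
- by [].
- by move=> _ fE _ _; apply: LocsBoundary; apply: fE; rewrite mem_head.
- rewrite inE andbT => ab fE opp _; apply: LocsInterior; [apply: fE|apply: fE|apply: opp => //];
  by rewrite !inE eqxx ?orbT.
(* Three local faces would have pairwise opposite normals, which forces a unit normal to vanish. *)
- rewrite !inE !negb_or => /andP[/and3P[ab ac _] /andP[/andP[bc _] _]] _ opp _.
  have := opp b c; rewrite (opp a b) ?(opp a c) ?inE ?eqxx ?orbT// opprK => /(_ isT isT bc) /eqP.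
  rewrite -subr_eq0 -opprD oppr_eq0 => /eqP a0; have := dotv_nrm a.1 a.2.
  have -> : nrm M a.1 a.2 = 0.
    by apply/rowP => i; have /rowP/(_ i) := a0; rewrite !mxE; lra.
  by rewrite dotv0l => /eqP; rewrite eq_sym oner_eq0.
Qed.

(** Trace unknowns are prescribed only on their faces; this allows replacing them by polynomials
    that agree with them there. *)
Lemma eq_surfInt e j g h : (forall x, lface M e j x -> g x = h x) ->
  surfInt M e j g = surfInt M e j h.
Proof.
move=> gh; rewrite !surfIntE; congr (_ * _); apply: eq_sint => l rl; apply: gh.
by apply/(facetP _ (vtx_nondegenerate e)); exists l.
Qed.

Lemma surfIntD e j g h : polyfun g -> polyfun h ->
  surfInt M e j (fun x => g x + h x) = surfInt M e j g + surfInt M e j h.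
Proof.
move=> pg ph; rewrite !surfIntE /fint -mulrDr; congr (_ * _).
exact: (sintD simplex_model12 _ _ (polyfun_apar _ _ _ _ pg) (polyfun_apar _ _ _ _ ph)).
Qed.

Lemma surfIntZ e j c g : polyfun g ->
  surfInt M e j (fun x => c * g x) = c * surfInt M e j g.
Proof.
move=> pg; rewrite !surfIntE /fint mulrCA; congr (_ * _).
exact: (sintZ simplex_model12 _ _ (polyfun_apar _ _ _ _ pg)).
Qed.

Lemma surfInt0 e j g : (forall x, g x = 0) -> surfInt M e j g = 0.
Proof.
move=> g0; rewrite surfIntE /fint /sint iint0 ?mulr0// => l.
by rewrite g0 mulr0.
Qed.

Lemma surfInt_ge0 e j g : (forall x, 0 <= g x) -> 0 <= surfInt M e j g.
Proof.
move=> g0; rewrite surfIntE mulr_ge0 ?sqrtr_ge0// iint_ge0// => l.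
by rewrite mulr_ge0// indicE ler0n.
Qed.

Lemma surfInt_eq0 e j g : polyfun g -> (forall x, 0 <= g x) -> surfInt M e j g = 0 ->
  forall x, lface M e j x -> g x = 0.
Proof.
move=> pg g0; rewrite surfIntE => /eqP; rewrite mulf_eq0 => /orP[|/eqP g_0 x].
  by rewrite sqrtr_eq0 leNgt facet_gram_gt0//; exact: vtx_nondegenerate.
move=> /(facetP _ (vtx_nondegenerate e))[l rl ->].
by apply: (sint_eq0 simplex_model12 _ _ _ g_0) rl => //; exact: polyfun_apar.
Qed.

(** The two local faces have the same vertices up to order, and the surface integral of a polynomial
    ignores that order. *)
Lemma surfInt_shared e j e' j' g : fidx M e j = fidx M e' j' -> polyfun g ->
  surfInt M e' j' g = surfInt M e j g.
Proof.
move=> /fidx_lface jj' pg; have nd := vtx_nondegenerate.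
have [s sP] := facet_vtx_perm _ _ _ _ (nd e) (nd e') jj'.
rewrite !surfIntE -[RHS](fint_perm n n12 s)//; congr fint.
by apply/funext => i; rewrite sP.
Qed.

Lemma faceIntE f ej g : ej \in locs M f -> polyfun g ->
  faceInt M f g = surfInt M ej.1 ej.2 g.
Proof.
move=> ejf pg; rewrite /faceInt (eq_big_seq (fun=> surfInt M ej.1 ej.2 g)) => [|ej' ej'f].
  rewrite big_const_seq count_predT iter_addr_0 -[X in _ * X]mulr_natl mulKf//.
  by rewrite pnatr_eq0 -lt0n; case: (locs M f) ejf.
apply: surfInt_shared => //.
by move: ejf ej'f; rewrite !mem_locs => /eqP -> /eqP ->.
Qed.

Lemma lface_faceset f ej x : ej \in locs M f -> faceset M f x -> lface M ej.1 ej.2 x.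
Proof.
rewrite mem_locs => /eqP <- [e [j [ejE xej]]].
by rewrite -(fidx_lface _ _ _ _ ejE).
Qed.

End Conforming.
End Mesh.

(** * The H-IP and UIP-DG forms *)

Section Forms.
Context {R : realType} {n : nat} (M : mesh R n) (Omega : set 'rV[R]_n.+1).
Context (kappa : 'I_(nE M) -> 'M[R]_n.+1).
Hypothesis conf : conforming_mesh Omega M.
Hypothesis n12 : (n = 1 \/ n = 2)%N.
Implicit Types (e : 'I_(nE M)) (j : 'I_n.+2) (f : 'I_(nF M)) (u v : Vh M) (uh vh : Vhat M)
  (x : 'rV[R]_n.+1).

Lemma kgradE u e x c : dotv (kgrad M kappa u e x) c = dotv (c *m kappa e) (grad (u e) x).
Proof. by rewrite dotvC /dotv /kgrad trmxK mulmxA. Qed.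

Lemma polyfun_kgrad u e i : polyfun (fun x => kgrad M kappa u e x 0 i).
Proof.
under eq_fun do rewrite !mxE; apply: polyfun_sum => k; apply: polyfunM (polyfun_cst _) _.
by under eq_fun do rewrite !mxE; exact: polyfun_ev.
Qed.

Lemma polyfun_kgrad_dot u e c : polyfun (fun x => dotv (kgrad M kappa u e x) c).
Proof. by apply: polyfun_dotv => i; [exact: polyfun_kgrad|exact: polyfun_cst]. Qed.

Lemma kgrad0 e x : kgrad M kappa (fun=> 0) e x = 0.
Proof. by rewrite /kgrad grad0 trmx0 mulmx0 trmx0. Qed.

(** * Both forms for an arbitrary positive penalty *)

Section Penalty.
Context (tau : 'I_(nE M) -> 'I_n.+2 -> R) (eps : R).
Hypothesis tau_gt0 : forall e j, 0 < tau e j.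

Lemma tsum_gt0 f : 0 < tsum M tau f.
Proof.
rewrite /tsum; case: (locsP M Omega conf f) => [a _|a b _ _ _].
  by rewrite big_seq1.
by rewrite big_cons big_seq1 addr_gt0.
Qed.

(** The conservative trace as a formal polynomial. The normal flux is written with [kappa] moved
    onto the normal, as a linear combination of partial derivatives, so that the degree bound can be
    read off. *)
Definition hatpoly u f : Defs.poly R n :=
  if interiorF M f then
    \sum_(ej <- locs M f) omega M tau ej.1 ej.2 *: u ej.1 -
    rho1 M tau f *: \sum_(ej <- locs M f)
      \sum_i (nrm M ej.1 ej.2 *m kappa ej.1) 0 i *: mpoly.mderiv i (u ej.1)
  else 0.

Lemma ev_hatpoly u f x : ev (hatpoly u f) x = hat_of M kappa tau u f x.
Proof.
rewrite /hatpoly /hat_of; case: ifP => _; last exact: ev0.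
rewrite evB evZ !ev_sum /wavg /kjmp; congr (_ - _ * _).
  by apply: eq_bigr => ej _; rewrite evZ.
apply: eq_bigr => ej _; rewrite ev_sum kgradE dotvE.
by apply: eq_bigr => i _; rewrite evZ [grad _ _ _ _]mxE.
Qed.

Lemma degle_hatpoly k u f : inVh M k u -> degle k (hatpoly u f).
Proof.
move=> uk; rewrite /hatpoly; case: ifP => _; last exact: degle0.
apply: degleB; first by apply: degle_sum => ej; apply: degleZ.
apply/degleZ/degle_sum => ej; apply: degle_sum => i.
exact/degleZ/degle_mderiv.
Qed.

Lemma inVhat_hat_of k u : inVh M k u -> inVhat M k (hat_of M kappa tau u).
Proof.
move=> uk f; split.
  by exists (hatpoly u f); split=> [|x _]; [exact: degle_hatpoly|rewrite ev_hatpoly].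
by rewrite /hat_of => /negbTE ->.
Qed.

Definition fluxF u uh v vh e j x : R :=
  dotv (- kgrad M kappa u e x + (tau e j * (ev (u e) x - uh (fidx M e j) x)) *: nrm M e j)
       ((ev (v e) x - vh (fidx M e j) x) *: nrm M e j).

Definition symF u uh v e j x : R :=
  dotv (- kgrad M kappa v e x) ((ev (u e) x - uh (fidx M e j) x) *: nrm M e j).

Lemma fluxFE u uh v vh e j x : fluxF u uh v vh e j x =
  (tau e j * (ev (u e) x - uh (fidx M e j) x) - dotv (kgrad M kappa u e x) (nrm M e j)) *
  (ev (v e) x - vh (fidx M e j) x).
Proof.
by rewrite /fluxF dotvZr dotvDl dotvNl dotvZl (dotv_nrm _ _ conf) mulr1 mulrC addrC.
Qed.

Lemma symFE u uh v e j x : symF u uh v e j x =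
  - dotv (kgrad M kappa v e x) (nrm M e j) * (ev (u e) x - uh (fidx M e j) x).
Proof. by rewrite /symF dotvZr dotvNl mulrC. Qed.

Lemma polyfun_fluxF u uh v vh e j : (forall f, polyfun (uh f)) -> (forall f, polyfun (vh f)) ->
  polyfun (fluxF u uh v vh e j).
Proof.
move=> puh pvh; apply: (eq_polyfun _ _ (fun x => esym (fluxFE u uh v vh e j x))).
apply: polyfunM; last by apply: polyfunB => //; exact: polyfun_ev.
apply: polyfunB; last exact: polyfun_kgrad_dot.
by apply: polyfunM (polyfun_cst _) _; apply: polyfunB => //; exact: polyfun_ev.
Qed.

Lemma polyfun_symF u uh v e j : (forall f, polyfun (uh f)) -> polyfun (symF u uh v e j).
Proof.
move=> puh; apply: (eq_polyfun _ _ (fun x => esym (symFE u uh v e j x))).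
apply: polyfunM; last by apply: polyfunB => //; exact: polyfun_ev.
by apply: polyfunN; exact: polyfun_kgrad_dot.
Qed.

Lemma aHIPE u uh v vh : aHIP M kappa tau eps u uh v vh = volForm M kappa u v +
  \sum_f (\sum_(ej <- locs M f) surfInt M ej.1 ej.2 (fluxF u uh v vh ej.1 ej.2) +
    eps * \sum_(ej <- locs M f) surfInt M ej.1 ej.2 (symF u uh v ej.1 ej.2)).
Proof.
rewrite /aHIP -addrA; congr (_ + _).
by rewrite !sum_local_faces big_split /= mulr_sumr.
Qed.

Lemma eq_aHIP u uh uh' v vh vh' :
  (forall f x, faceset M f x -> uh f x = uh' f x) ->
  (forall f x, faceset M f x -> vh f x = vh' f x) ->
  aHIP M kappa tau eps u uh v vh = aHIP M kappa tau eps u uh' v vh'.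
Proof.
move=> uhE vhE; have fe e j x : lface M e j x -> faceset M (fidx M e j) x by exists e, j.
rewrite /aHIP; congr (_ + _ + _ * _); apply: eq_bigr => e _; apply: eq_bigr => j _;
  apply: (eq_surfInt _ _ conf) => x /fe fx; rewrite ?uhE ?vhE//.
Qed.

Lemma polyfun_jmp v f i : polyfun (fun x => jmp M v f x 0 i).
Proof.
under eq_fun do rewrite /jmp summxE; apply: polyfun_sum => ej.
by under eq_fun do rewrite mxE; apply: polyfunM (polyfun_ev _) (polyfun_cst _).
Qed.

Lemma polyfun_kjmp v f : polyfun (kjmp M kappa v f).
Proof. by apply: polyfun_sum => ej; exact: polyfun_kgrad_dot. Qed.

Lemma polyfun_kavgstar v f i : polyfun (fun x => kavgstar M kappa tau v f x 0 i).
Proof.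
rewrite /kavgstar; case: (interiorF M f); under eq_fun do rewrite summxE; apply: polyfun_sum => ej.
  by under eq_fun do rewrite mxE; apply: polyfunM (polyfun_cst _) (polyfun_kgrad _ _ _).
exact: polyfun_kgrad.
Qed.

(** The UIP-DG face integrand, with the scalar factors in front so that linearity of the surface
    integral applies term by term. *)
Definition uipF u v f x : R :=
  (- 1) * dotv (kavgstar M kappa tau u f x) (jmp M v f x)
  + (- eps) * dotv (kavgstar M kappa tau v f x) (jmp M u f x)
  + rho0 M tau f * dotv (jmp M u f x) (jmp M v f x)
  + (- eps) * (if interiorF M f then rho1 M tau f * kjmp M kappa u f x * kjmp M kappa v f x else 0).

Lemma locs_witness f : exists ej, ej \in locs M f.
Proof.
by case: (locsP M Omega conf f) => [a _|a b _ _ _]; exists a; rewrite mem_head.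
Qed.

Lemma aUIPE u v : aUIP M kappa tau eps u v =
  volForm M kappa u v + \sum_f faceInt M f (uipF u v f).
Proof.
have -> : \sum_f faceInt M f (uipF u v f) = \sum_f (
    - faceInt M f (fun x => dotv (kavgstar M kappa tau u f x) (jmp M v f x))
    - eps * faceInt M f (fun x => dotv (kavgstar M kappa tau v f x) (jmp M u f x))
    + faceInt M f (fun x => rho0 M tau f * dotv (jmp M u f x) (jmp M v f x))
    - eps * if interiorF M f then
      faceInt M f (fun x => rho1 M tau f * kjmp M kappa u f x * kjmp M kappa v f x) else 0).
  apply: eq_bigr => f _; have [ej ejf] := locs_witness f.
  have pac w z : polyfun (fun x => dotv (kavgstar M kappa tau w f x) (jmp M z f x)).
    by apply: polyfun_dotv; [exact: polyfun_kavgstar|exact: polyfun_jmp].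
  have pjj : polyfun (fun x => rho0 M tau f * dotv (jmp M u f x) (jmp M v f x)).
    by apply: polyfunM (polyfun_cst _) _; apply: polyfun_dotv; exact: polyfun_jmp.
  have pkk : polyfun (fun x => rho1 M tau f * kjmp M kappa u f x * kjmp M kappa v f x).
    by apply: polyfunM; [apply: polyfunM (polyfun_cst _) _|]; exact: polyfun_kjmp.
  have pI : polyfun (fun x => if interiorF M f
      then rho1 M tau f * kjmp M kappa u f x * kjmp M kappa v f x else 0).
    by case: (interiorF M f) => //; exact: polyfun_cst.
  have S g : polyfun g -> faceInt M f g = surfInt M ej.1 ej.2 g.
    exact: (faceIntE _ _ conf n12).
  have cp c g : polyfun g -> polyfun (fun x => c * g x) by exact: polyfunM (polyfun_cst c).
  have E0 : surfInt M ej.1 ej.2 (fun x => if interiorF M f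
      then rho1 M tau f * kjmp M kappa u f x * kjmp M kappa v f x else 0) =
    if interiorF M f then surfInt M ej.1 ej.2
      (fun x => rho1 M tau f * kjmp M kappa u f x * kjmp M kappa v f x) else 0.
    by case: (interiorF M f) => //; rewrite surfInt0.
  have p1 := cp (- 1) _ (pac u v); have p2 := cp (- eps) _ (pac v u).
  have p4 := cp (- eps) _ pI.
  have p12 := polyfunD p1 p2; have p123 := polyfunD p12 pjj.
  rewrite S; last exact: polyfunD p123 p4.
  rewrite [LHS](surfIntD _ n12 _ _ _ _ p123 p4).
  rewrite (surfIntD _ n12 _ _ _ _ p12 pjj) (surfIntD _ n12 _ _ _ _ p1 p2).
  rewrite (surfIntZ _ n12 _ _ _ _ (pac u v)) (surfIntZ _ n12 _ _ _ _ (pac v u)).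
  rewrite (surfIntZ _ n12 _ _ _ _ pI) E0.
  by rewrite !S// mulN1r !mulNr.
rewrite /aUIP /acF /shF [\sum_(f < nF M | interiorF M f) _]big_mkcond /=.
rewrite !sumrB big_split /= !sumrB sumrN -!mulr_sumr.
by ring.
Qed.

(** All local faces of [f] carry the same surface integral, so the contributions of both sides are
    gathered under a single integral, where they can be compared pointwise. *)
Lemma sum_face_terms u uh v vh f :
  (forall f, polyfun (uh f)) -> (forall f, polyfun (vh f)) ->
  (forall f, ~~ interiorF M f -> forall x, uh f x = 0) ->
  (forall f, ~~ interiorF M f -> forall x, vh f x = 0) ->
  forall ej, ej \in locs M f ->
  \sum_(ej <- locs M f) surfInt M ej.1 ej.2 (fluxF u uh v vh ej.1 ej.2) +
    eps * \sum_(ej <- locs M f) surfInt M ej.1 ej.2 (symF u uh v ej.1 ej.2) =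
  surfInt M ej.1 ej.2 (fun x => \sum_(ej <- locs M f) fluxF u uh v vh ej.1 ej.2 x +
    eps * \sum_(ej <- locs M f) symF u uh v ej.1 ej.2 x).
Proof.
move=> puh pvh uh0 vh0 ej ejf.
have pf e j := polyfun_fluxF u uh v vh e j puh pvh.
have ps e j := polyfun_symF u uh v e j puh.
have sumS (G : 'I_(nE M) -> 'I_n.+2 -> 'rV[R]_n.+1 -> R) : (forall e j, polyfun (G e j)) ->
    \sum_(ej' <- locs M f) surfInt M ej'.1 ej'.2 (G ej'.1 ej'.2) =
    surfInt M ej.1 ej.2 (fun x => \sum_(ej' <- locs M f) G ej'.1 ej'.2 x).
  move=> pG; rewrite (eq_big_seq (fun ej' => surfInt M ej.1 ej.2 (G ej'.1 ej'.2))); last first.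
    move=> ej' ej'f; apply: (surfInt_shared _ _ conf n12) => //.
    by move: ejf ej'f; rewrite !mem_locs => /eqP -> /eqP ->.
  elim: (locs M f) => [|a s IH].
    by rewrite big_nil surfInt0// => x; rewrite big_nil.
  rewrite big_cons IH -(surfIntD _ n12)//; last exact: polyfun_sum.
  by congr surfInt; apply/funext => x; rewrite big_cons.
rewrite (sumS _ pf) (sumS _ ps) -(surfIntZ _ n12); last exact: polyfun_sum.
rewrite -(surfIntD _ n12)//; first exact: polyfun_sum.
by apply: polyfunM (polyfun_cst _) _; exact: polyfun_sum.
Qed.

Lemma sum_fluxF u uh v vh f x :
  \sum_(ej <- locs M f) fluxF u uh v vh ej.1 ej.2 x = \sum_(ej <- locs M f)
    (tau ej.1 ej.2 * (ev (u ej.1) x - uh f x) -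
      dotv (kgrad M kappa u ej.1 x) (nrm M ej.1 ej.2)) * (ev (v ej.1) x - vh f x).
Proof. by apply: eq_big_seq => ej; rewrite mem_locs fluxFE => /eqP ->. Qed.

Lemma sum_symF u uh v f x :
  \sum_(ej <- locs M f) symF u uh v ej.1 ej.2 x = \sum_(ej <- locs M f)
    - dotv (kgrad M kappa v ej.1 x) (nrm M ej.1 ej.2) * (ev (u ej.1) x - uh f x).
Proof. by apply: eq_big_seq => ej; rewrite mem_locs symFE => /eqP ->. Qed.

(** With outward normal [n_a] on the first side, the flux there becomes [rho0 [u] . n_a - {kappa
    grad u}^* . n_a] and the other side gives its opposite, so [vh] cancels. The two factors
    [u_i - hat u] in the symmetry term produce [- {kappa grad v}^* . [u]] and the [rho1] term. *)
Lemma uipF_hat u v vh f x : (~~ interiorF M f -> vh f x = 0) ->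
  \sum_(ej <- locs M f) fluxF u (hat_of M kappa tau u) v vh ej.1 ej.2 x +
    eps * \sum_(ej <- locs M f) symF u (hat_of M kappa tau u) v ej.1 ej.2 x = uipF u v f x.
Proof.
rewrite sum_fluxF sum_symF /hat_of /uipF /kavgstar /jmp /kjmp /wavg /rho0 /rho1 /omega.
have := tsum_gt0 f; have tE : tsum M tau f = \sum_(ej <- locs M f) tau ej.1 ej.2 by [].
move: tE; set T := tsum M tau f.
have nn e j := dotv_nrm M Omega conf e j.
case: (locsP M Omega conf f) => [a fa|a b fa fb nb] tE T0 vh0.
  (* On a boundary face both traces are 0 and the weight sum is the single penalty value. *)
  rewrite !big_seq1 in tE *; rewrite vh0//.
  rewrite !dotvZr !dotvZl nn tE; ring.
have sum2 (V : nmodType) (G : 'I_(nE M) * 'I_n.+2 -> V) :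
    \sum_(ej <- [:: a; b]) G ej = G a + G b by rewrite big_cons big_seq1.
have prod2 (G : 'I_(nE M) * 'I_n.+2 -> R) :
    \prod_(ej <- [:: a; b]) G ej = G a * G b by rewrite big_cons big_seq1.
rewrite !sum2 prod2 fa fb -/T nb in tE *.
rewrite !(dotvDl, dotvDr, dotvZl, dotvZr, dotvNl, dotvNr) nn.
have TE0 : tau a.1 a.2 + tau b.1 b.2 != 0 by rewrite -tE gt_eqF.
rewrite tE.
by field.
Qed.

Lemma aHIP_hat u v vh : (forall f, polyfun (vh f)) ->
  (forall f, ~~ interiorF M f -> forall x, vh f x = 0) ->
  aHIP M kappa tau eps u (hat_of M kappa tau u) v vh = aUIP M kappa tau eps u v.
Proof.
move=> pvh vh0; rewrite aHIPE aUIPE; congr (_ + _); apply: eq_bigr => f _.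
have [ej ejf] := locs_witness f.
have phat f' : polyfun (hat_of M kappa tau u f').
  by apply: eq_polyfun (polyfun_ev (hatpoly u f')) => x; rewrite ev_hatpoly.
have E x := uipF_hat u v vh f x (fun bf => vh0 f bf x).
rewrite (sum_face_terms _ _ _ _ _ phat pvh _ _ ej ejf)//; last first.
  by move=> f' /negbTE bf x; rewrite /hat_of bf.
rewrite (faceIntE _ _ conf n12 _ _ _ ejf).
  by congr surfInt; apply/funext => x; exact: E.
apply: (eq_polyfun _ _ E); apply: polyfunD.
  by apply: polyfun_sum => ?; exact: polyfun_fluxF.
by apply: polyfunM (polyfun_cst _) _; apply: polyfun_sum => ?; exact: polyfun_symF.
Qed.

(** Representatives that are polynomial on the whole space and vanish identically for boundary
    faces, as the linearity of surface integrals requires. *)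
Lemma inVhat_poly k vh : inVhat M k vh -> exists P : 'I_(nF M) -> Defs.poly R n,
  (forall f, degle k (P f)) /\
  (forall f, ~~ interiorF M f -> P f = 0) /\
  forall f x, faceset M f x -> vh f x = ev (P f) x.
Proof.
move=> vk; have [P PE] := choice (fun f => (vk f).1).
exists (fun f => if interiorF M f then P f else 0); split; [|split].
- by move=> f; case: ifP => _; [have [] := PE f|exact: degle0].
- by move=> f /negbTE ->.
- move=> f x fx; case: (boolP (interiorF M f)) => bf; first by have [_ ->] := PE f.
  by rewrite ev0; have [_ ->] := vk f.
Qed.

Lemma volForm0 u : volForm M kappa u (fun=> 0) = 0.
Proof.
rewrite /volForm big1// => e _; rewrite /elemInt iint0// => x.
by rewrite grad0 dotv0r mulr0.
Qed.

Lemma rhs0 (F : 'rV[R]_n.+1 -> R) : rhs M F (fun=> 0) = 0.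
Proof.
rewrite /rhs big1// => e _; rewrite /elemInt iint0// => x.
by rewrite ev0 !mulr0.
Qed.

Lemma HIP_sol_hat k (F : 'rV[R]_n.+1 -> R) u uh : HIP_sol M kappa tau k eps F u uh ->
  forall f x, faceset M f x -> uh f x = hat_of M kappa tau u f x.
Proof.
move=> [uk [uhk sol]] f0 x0 f0x0.
have [if0|bf0] := boolP (interiorF M f0); last first.
  by rewrite (uhk f0).2// /hat_of (negbTE bf0).
have [P [Pk [P0 PE]]] := inVhat_poly _ _ uhk.
(* The defect of [uh] on [f0] is itself an admissible trace, since the conservative trace has degree
   at most [k]; it serves as the test function. *)
pose q := hatpoly u f0 - P f0.
pose vh : Vhat M := fun f x => if f == f0 then ev q x else 0.
have vhk : inVhat M k vh.
  move=> f; rewrite /vh; have [->|ff0] := eqVneq f f0; last by split=> //; exists 0;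
    split=> [|x _]; rewrite ?degle0 ?ev0.
  split; last by rewrite if0.
  by exists q; split=> //; apply: degleB => //; exact: degle_hatpoly.
have := sol (fun=> 0) vh (fun=> degle0 _) vhk.
rewrite rhs0 (eq_aHIP _ _ (fun f => ev (P f)) _ _ vh)// aHIPE volForm0 add0r.
have pP f : polyfun (ev (P f)) by exact: polyfun_ev.
have pvh f : polyfun (vh f) by rewrite /vh; case: eqP => _; [exact: polyfun_ev|exact: polyfun_cst].
have P0x f : ~~ interiorF M f -> forall x, ev (P f) x = 0 by move=> bf x; rewrite P0// ev0.
have vh0 f : ~~ interiorF M f -> forall x, vh f x = 0.
  by rewrite /vh; have [->|] := eqVneq f f0; rewrite ?if0.
have sym0 f x : \sum_(ej <- locs M f) symF u (fun f => ev (P f)) (fun=> 0) ej.1 ej.2 x = 0.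
  by rewrite sum_symF big1// => ej _; rewrite kgrad0 dotv0l oppr0 mul0r.
rewrite (bigD1 f0)//= [X in _ + X]big1 => [|f ff0]; last first.
  have [ej ejf] := locs_witness f.
  rewrite (sum_face_terms _ _ _ _ _ pP pvh P0x vh0 ej ejf) surfInt0// => x.
  rewrite sym0 sum_fluxF /vh (negbTE ff0) mulr0 addr0 big1// => ? _.
  by rewrite ev0 subrr mulr0.
have [ej ejf] := locs_witness f0.
rewrite addr0 (sum_face_terms _ _ _ _ _ pP pvh P0x vh0 ej ejf).
have flux x : \sum_(ej <- locs M f0) fluxF u (fun f => ev (P f)) (fun=> 0) vh ej.1 ej.2 x +
    eps * \sum_(ej <- locs M f0) symF u (fun f => ev (P f)) (fun=> 0) ej.1 ej.2 x =
    - tsum M tau f0 * ev q x ^+ 2.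
  rewrite sym0 mulr0 addr0 sum_fluxF.
  have -> : vh f0 x = ev q x by rewrite /vh eqxx.
  (* The fluxes of the conservative trace sum to zero over the two sides, so for [P f0] their sum is
     the total penalty times the defect. *)
  have qE : tsum M tau f0 * ev q x = \sum_(ej <- locs M f0)
     (tau ej.1 ej.2 * (ev (u ej.1) x - ev (P f0) x) -
      dotv (kgrad M kappa u ej.1 x) (nrm M ej.1 ej.2)).
    rewrite /q evB ev_hatpoly /hat_of if0 /wavg /kjmp /rho1 mulrBr mulrBr.
    rewrite mulrA divff ?gt_eqF ?tsum_gt0// mul1r mulr_sumr sumrB.
    under [in RHS]eq_bigr do rewrite mulrBr.
    rewrite sumrB -mulr_suml -/(tsum M tau f0) addrAC; congr (_ - _ - _).
    apply: eq_big_seq => ej'; rewrite mem_locs /omega => /eqP ->.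
    by rewrite mulrA [X in X * _]mulrCA divff ?mulr1// gt_eqF// tsum_gt0.
  rewrite mulNr expr2 mulrA qE mulr_suml -mulN1r mulr_sumr; apply: eq_bigr => ej' _.
  by rewrite ev0 sub0r mulrN mulN1r.
rewrite (_ : (fun x => _) = (fun x => - tsum M tau f0 * ev q x ^+ 2)); last exact/funext.
have pq2 : polyfun (fun x => ev q x ^+ 2) by apply/polyfunX/polyfun_ev.
rewrite (surfIntZ _ n12)// => /eqP.
rewrite mulf_eq0 oppr_eq0 (gt_eqF (tsum_gt0 f0)) /= => /eqP /(surfInt_eq0 _ _ conf n12).
move=> /(_ pq2 (fun x => sqr_ge0 _) x0 (lface_faceset _ _ conf _ _ _ ejf f0x0)) /eqP.
rewrite sqrf_eq0 /q evB subr_eq0 ev_hatpoly => /eqP ->.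
exact: PE.
Qed.

End Penalty.

(** The only delicate factor is the inverse diameter. The trace inequality for the constant 1 bounds
    a positive face area by this factor times a nonnegative quantity, so it cannot be
    nonpositive. *)
Lemma tauEF_gt0 (kmin kmax alpha0 CT : R) (k : nat) e j :
  kappa_ok M kappa kmin kmax -> trace_const M k CT -> 0 < alpha0 ->
  0 < tauEF M kappa alpha0 CT e j.
Proof.
move=> [kmin0 [_ kok]] [CT0 trace] alpha0_gt0.
have nk : 0 < dotv (nrm M e j *m kappa e) (nrm M e j).
  have [_ /(_ (nrm M e j))/andP[+ _]] := kok e.
  by rewrite (dotv_nrm _ _ conf) mulr1; exact: lt_le_trans kmin0.
have one x : ev (1 : Defs.poly R n) x ^+ 2 = 1 by rewrite ev1 expr1n.
have := trace e j 1 (degle1 _); under [X in elemInt _ _ X]eq_fun do rewrite one.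
set V := elemInt _ _ _ => tr.
have V0 : 0 <= V by apply: iint_ge0 => x; rewrite mulr1 indicE ler0n.
have S0 : 0 < surfInt M e j (fun x => ev (1 : Defs.poly R n) x ^+ 2).
  rewrite lt_def surfInt_ge0 => [|x]; last exact: sqr_ge0.
  rewrite andbT; apply/eqP => /(surfInt_eq0 _ _ conf n12).
  have x1 : lface M e j (vtx M e (lift j ord0)).
    by apply: hullset_vtx; [exact: (vtx_nondegenerate _ _ conf)|rewrite !inE eq_sym neq_lift].
  move=> /(_ (polyfunX _ _ (polyfun_ev _)) (fun x => sqr_ge0 _) _ x1) /eqP.
  by rewrite one oner_eq0.
rewrite /tauEF !mulr_gt0// ?exprn_gt0// ltNge; apply/negP => h0.
have := lt_le_trans S0 tr; rewrite ltNge => /negP; apply.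
by rewrite mulr_le0_ge0// mulr_ge0_le0// exprn_ge0// ltW.
Qed.

End Forms.

(* Space dimension d = n.+1 in {2,3}. *)
Theorem mainTheorem4 (R : realType) (n : nat) (Omega : set 'rV[R]_n.+1) (M : mesh R n)
    (kappa : 'I_(nE M) -> 'M[R]_n.+1) (kmin kmax : R) (k : nat) (alpha0 CT : R)
    (eps : R) (f : 'rV[R]_n.+1 -> R) :
  (n.+1 = 2 \/ n.+1 = 3)%N ->
  lipschitz_domain Omega ->
  conforming_mesh Omega M ->
  meshsize M <= 1 ->
  kappa_ok M kappa kmin kmax ->
  (1 <= k)%N ->
  trace_const M k CT ->
  0 < alpha0 ->
  (eps = -1 \/ eps = 0 \/ eps = 1) ->
  L2 Omega f ->
  let tau := tauEF M kappa alpha0 CT in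
  (* (i) *)
  (forall (u : Vh M) (uh : Vhat M), HIP_sol M kappa tau k eps f u uh ->
     UIP_sol M kappa tau k eps f u) /\
  (* (ii) *)
  (forall u : Vh M, UIP_sol M kappa tau k eps f u ->
     let uh := hat_of M kappa tau u in
     inVhat M k uh /\ HIP_sol M kappa tau k eps f u uh /\
     (HIP_unique M kappa tau k eps f ->
        forall (w : Vh M) (wh : Vhat M), HIP_sol M kappa tau k eps f w wh -> Veq M u uh w wh)).
Proof.
move=> d23 _ conf _ kok _ trace alpha0_gt0 _ _ tau.
have n12 : (n = 1 \/ n = 2)%N by case: d23 => -[->]; [left|right].
have tau0 e j : 0 < tau e j by exact: (tauEF_gt0 _ _ _ conf n12 _ _ _ _ _ _ _ kok trace).
have zero_in : inVhat M k (fun _ _ => 0).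
  by move=> g; split=> //; exists 0; split=> [|x _]; rewrite ?degle0 ?ev0.
split=> [u uh sol|u [uk uip]].
  (* The trace unknown is exchanged for the conservative trace on the faces; testing with zero trace
     then yields the UIP-DG equation. *)
  have hat := HIP_sol_hat _ _ _ conf n12 _ _ tau0 _ _ _ _ sol.
  have [uk [_ hip]] := sol; split=> // v vk.
  rewrite -(hip v (fun _ _ => 0) vk zero_in).
  rewrite (eq_aHIP _ _ _ conf _ _ _ _ _ _ _ (fun _ _ => 0) hat)//.
  by rewrite (aHIP_hat _ _ _ conf n12 _ _ tau0)// => g; exact: polyfun_cst.
move=> uh; have uhk : inVhat M k uh by exact: inVhat_hat_of.
have hsol : HIP_sol M kappa tau k eps f u uh.
  split=> //; split=> // v vh vk vhk.
  have [P [_ [P0 PE]]] := inVhat_poly _ _ _ vhk.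
  rewrite (eq_aHIP _ _ _ conf _ _ _ uh uh _ _ (fun g => ev (P g)))//.
  rewrite (aHIP_hat _ _ _ conf n12 _ _ tau0) ?uip// => g; first exact: polyfun_ev.
  by move=> bg x; rewrite P0// ev0.
split=> //; split=> // -[w0 [wh0 [_ uniq]]] w wh wsol.
(* Both solutions are compared with the one supplied by the uniqueness hypothesis. *)
have [uw uhw] := uniq _ _ hsol; have [ww whw] := uniq _ _ wsol.
by split=> [|g x gx]; [rewrite -uw|rewrite -uhw// whw].
Qed.
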